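(* Let $\rho=\lambda-(\sup(p_0)-\inf(p_0))$ and assume that $$\mathbf{Q_1}=\sup_{i\in F^*}\sum_{j\in F^*,\,j\ne i}Q_{i,j}<+\infty\quad\text{and}\quad \mathbf{p}=\sup_{i\in F^*}p_0(i)<+\infty.$$ Then for all $k,l\in F^*$, $\eta\in E$ and $t\ge0$, $$\left|\mathbb{E}_\eta\Big[\frac{\eta_t(k)}{N}\frac{\eta_t(l)}{N}\Big]-\mathbb{E}_\eta\Big[\frac{\eta_t(k)}{N}\Big]\mathbb{E}_\eta\Big[\frac{\eta_t(l)}{N}\Big]\right|\le\frac{2(\mathbf{Q_1}+\mathbf{p})}{N-1}\,\frac{1-e^{-2\rho t}}{\rho},$$ with the convention $(1-e^{-2\rho t})\rho^{-1}=2t$ when $\rho=0$.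
   Context: $F^*$ is a (finite or infinite) countable discrete set, and $(Q_{i,j})_{i,j\in F^*}$ is the transition rate matrix of an irreducible, positive recurrent continuous-time Markov process on $F^*$. The function $p_0:F^*\to[0,\infty)$ (death rate) is not identically zero; $\sup(p_0),\inf(p_0)$ are taken over $F^*$. The parameter $\lambda$ is $$\lambda=\inf_{i,i'\in F^*,\,i\ne i'}\Big(Q_{i,i'}+Q_{i',i}+\sum_{j\ne i,i'}Q_{i,j}\wedge Q_{i',j}\Big).$$ $N\ge2$ is an integer and $E=\{\eta:F^*\to\mathbb{N}:\sum_{i\in F^*}\eta(i)=N\}$. $T_{i\to j}\eta$ is obtained from $\eta$ by decreasing $\eta(i)$ by 1 and increasing $\eta(j)$ by 1 (when $\eta(i)\ne0$). The Fleming-Viot process $(\eta_t)_{t\ge0}$ with $N$ particles is the Markov process on $E$ with generator $$\mathcal{L}f(\eta)=\sum_{i\in F^*}\eta(i)\sum_{j\in F^*}\big(f(T_{i\to j}\eta)-f(\eta)\big)\Big(Q_{i,j}+p_0(i)\frac{\eta(j)}{N-1}\Big),$$ and $\mathbb{E}_\eta$ denotes expectation given $\eta_0=\eta$. *)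

(* Defs.v *)
From mathcomp Require Export all_boot all_order all_algebra.
From mathcomp Require Export all_classical all_reals all_analysis.

Set Implicit Arguments.
Unset Strict Implicit.
Unset Printing Implicit Defensive.

Export Order.TTheory GRing.Theory Num.Theory.
Export numFieldNormedType.Exports.

Local Open Scope classical_set_scope.
Local Open Scope ring_scope.

(* [esum] sums nonnegative families only, so an absolutely convergent signed
   sum is taken as (sum of positive parts) - (sum of negative parts). *)
Definition signed_sum (R : realType) (T : choiceType) (g : T -> R) : R :=
  fine (\esum_(j in [set: T]) (Num.max (g j) 0)%:E) -
  fine (\esum_(j in [set: T]) (Num.max (- g j) 0)%:E).

(* Events depending on [X u], [u <= s]; the state space is discrete, so every
   set of states is measurable. *)
Definition past (R : realType) (S Omega : Type) (X : R -> Omega -> S) (s : R)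
    : set (set Omega) :=
  <<s [set G | exists (u : R) (A : set S), 0 <= u <= s /\ G = X u @^-1` A] >>.

(* [P x] is the law started from [x]; only [x] in [D] and times [t >= 0]
   matter. *)
Definition markov_process (R : realType) (S : Type) (D : set S)
    (d : measure_display) (Omega : measurableType d)
    (P : S -> probability Omega R) (X : R -> Omega -> S) : Prop :=
  [/\ forall (t : R) w, 0 <= t -> D (X t w),
      forall (t : R) (A : set S), 0 <= t -> measurable (X t @^-1` A),
      forall x, D x -> P x [set w | X 0 w = x] = 1%E
    & forall x (s t : R) y (G : set Omega) (A : set S),
        D x -> D y -> 0 <= s -> 0 <= t -> past X s G ->
        P x (G `&` [set w | X s w = y] `&` (X (s + t) @^-1` A)) =
        (P x (G `&` [set w | X s w = y]) * P y (X t @^-1` A))%E].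

Definition bounded_on (R : realType) (S : Type) (D : set S) (f : S -> R) :=
  exists M : R, forall x, D x -> `|f x| <= M.

Definition has_generator (R : realType) (S : Type) (D : set S)
    (d : measure_display) (Omega : measurableType d)
    (P : S -> probability Omega R) (X : R -> Omega -> S)
    (L : (S -> R) -> S -> R) : Prop :=
  forall f, bounded_on D f -> forall x, D x ->
    (fine 'E_(P x)[f \o X t]%E - f x) / t @[t --> 0^'+] --> L f x.

Section OneParticle.
Variables (R : realType) (F : countType).
Implicit Types (Q : F -> F -> R).

Definition rate_matrix Q : Prop :=
  (forall i j, i != j -> 0 <= Q i j) /\
  (forall i, (\esum_(j in [set j | j != i]) (Q i j)%:E = (- Q i i)%:E)%E).

Definition rate_generator Q (f : F -> R) (i : F) : R :=
  signed_sum (fun j => Q i j * (f j - f i)).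

Definition right_continuous (S Omega : Type) (X : R -> Omega -> S) : Prop :=
  forall w (t : R), 0 <= t ->
    exists2 e : R, 0 < e & forall s, t <= s < t + e -> X s w = X t w.

(* First time at [i] after having left [i]; [+oo] if there is none. *)
Definition return_time (S Omega : Type) (X : R -> Omega -> S) (i : S)
    (w : Omega) : \bar R :=
  ereal_inf [set t%:E | t in [set t : R |
    exists s : R, [/\ 0 <= s < t, X s w <> i & X t w = i]]].

Definition irreducible_process (d : measure_display) (Omega : measurableType d)
    (P : F -> probability Omega R) (X : R -> Omega -> F) : Prop :=
  forall i j, exists2 t, 0 <= t & (0 < P i [set w | X t w = j])%E.

(* An absorbing state ([Q i i = 0]) counts as positive recurrent; for an
   irreducible process this can only happen on a one-point space. *)
Definition positive_recurrent_process Q (d : measure_display)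
    (Omega : measurableType d) (P : F -> probability Omega R)
    (X : R -> Omega -> F) : Prop :=
  forall i, Q i i = 0 \/ (\int[P i]_w return_time X i w < +oo)%E.

Definition irreducible_positive_recurrent Q : Prop :=
  rate_matrix Q /\
  exists (d : measure_display) (Omega : measurableType d)
      (P : F -> probability Omega R) (X : R -> Omega -> F),
    [/\ markov_process setT P X, right_continuous X,
        has_generator setT P X (rate_generator Q),
        irreducible_process P X & positive_recurrent_process Q P X].

Definition lambda Q : \bar R :=
  ereal_inf [set x | exists i i', i != i' /\
    x = ((Q i i' + Q i' i)%:E +
         \esum_(j in [set j | j != i /\ j != i'])
            (Num.min (Q i j) (Q i' j))%:E)%E].

Definition Q1 Q : \bar R :=
  ereal_sup (range (fun i => \esum_(j in [set j | j != i]) (Q i j)%:E)).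

Definition sup_death (p0 : F -> R) : \bar R := ereal_sup (range (fun i => (p0 i)%:E)).

Definition inf_death (p0 : F -> R) : \bar R := ereal_inf (range (fun i => (p0 i)%:E)).

Definition rho Q (p0 : F -> R) : \bar R :=
  (lambda Q - (sup_death p0 - inf_death p0))%E.

(* [(1 - e^(-2 r t)) / r].  The value [+oo] of [r] occurs only when [F] has one
   point, where [lambda] is the infimum of the empty set; 0 is the limit. *)
Definition decay (r : \bar R) (t : R) : R :=
  if r is u%:E then
    if u == 0 then 2 * t else (1 - expR (- (2 * u * t))) / u
  else 0.

End OneParticle.

Section Particles.
Variables (R : realType) (F : countType).

Definition configs (N : nat) : set (F -> nat) :=
  [set eta | (\esum_(i in [set: F]) ((eta i)%:R : R)%:E = (N%:R)%:E)%E].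

Definition move (i j : F) (eta : F -> nat) : F -> nat :=
  fun k => (eta k - (k == i) + (k == j))%N.

Definition fv_generator (Q : F -> F -> R) (p0 : F -> R) (N : nat)
    (f : (F -> nat) -> R) (eta : F -> nat) : R :=
  signed_sum (fun i => (eta i)%:R *
    signed_sum (fun j => (f (move i j eta) - f eta) *
      (Q i j + p0 i * ((eta j)%:R / (N%:R - 1))))).

Definition fleming_viot (Q : F -> F -> R) (p0 : F -> R) (N : nat)
    (d : measure_display) (Omega : measurableType d)
    (P : (F -> nat) -> probability Omega R) (X : R -> Omega -> F -> nat)
    : Prop :=
  markov_process (configs N) P X /\
  has_generator (configs N) P X (fv_generator Q p0 N).

End Particles.

Arguments configs R {F} N.

(* Main.v *)
(** The law of the particle system is a Markov semigroup [T] whose derivative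
    at 0 is the generator [L], and [L] is bounded by some [q] times the largest
    increment of a function along a single particle move.  Coupling two
    configurations that differ by one particle shows that [1 + h L] contracts
    the Lipschitz constant for one-particle moves by [1 - rho h], so [T t]
    contracts it by [exp (- rho t)].  Covariances satisfy
    [Cov_(t+h) (f, g) = T_h (Cov_t (f, g)) + Cov_h (T_t f, T_t g)], whose last
    term is at most [h q Lip (T_t f) Lip (T_t g) + O(h^2)]; cutting [0, t] in
    [n] steps and letting [n] tend to infinity gives
    [q Lip f Lip g (1 - exp (- 2 rho t)) / rho].  All error terms are uniform in
    the starting point, so no regularity of [t |-> T t f] beyond the existence
    of the generator is needed. *)
Require Import Defs.
From mathcomp Require Import measurable_realfun ring lra.

Set Implicit Arguments.
Unset Strict Implicit.
Unset Printing Implicit Defensive.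

Local Open Scope classical_set_scope.
Local Open Scope ring_scope.

(** The obstacle is that the generator is known only as a pointwise limit at time 0, while composing
    many short steps needs one error bound valid at all starting points. Uniformity comes from the
    chance of not having moved: it is at least 1 - (q+1) t from every start, so [T t] displaces a
    bounded function by O(t) uniformly, and telescoping turns this into a uniform O(h^2) error for 1
    + h L.

    The rate rho collects three effects on configurations that differ by one particle. The differing
    particles mutate to a common site, or one of them onto the other, at rate at least lambda. They
    die and land on the same common particle at rate at least inf p0. Common particles die and land
    on the differing one, which doubles the discrepancy, at total rate at most sup p0.

    The order 1/N of the bound arises because q is of order N while an occupation fraction changes
    by at most 1/N in one move, and the Lipschitz constant enters squared. *)

(** * Linearity and monotonicity of absolutely convergent signed sums *)

Section SignedSum.
Variables (R : realType) (T : choiceType).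
Implicit Types (g h : T -> R) (c : R).

Definition abs_summable g :=
  (\esum_(j in [set: T]) (`|g j|)%:E < +oo)%E.

Lemma esum_fin_numP g : (forall j, 0 <= g j) ->
  (\esum_(j in [set: T]) (g j)%:E < +oo)%E ->
  (\esum_(j in [set: T]) (g j)%:E)%E \is a fin_num.
Proof.
move=> g0 gf; rewrite ge0_fin_numE//.
by apply: esum_ge0 => j _; rewrite lee_fin.
Qed.

Lemma abs_summable_le g h : (forall j, `|g j| <= h j) ->
  (\esum_(j in [set: T]) (h j)%:E < +oo)%E -> abs_summable g.
Proof.
by move=> gh; apply: le_lt_trans; apply: le_esum => j _; rewrite lee_fin.
Qed.

Lemma abs_summableD g h : abs_summable g -> abs_summable h ->
  abs_summable (fun j => g j + h j).
Proof.
move=> ag ah; apply: (@abs_summable_le _ (fun j => `|g j| + `|h j|)).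
  by move=> j; exact: ler_normD.
under eq_esum do rewrite EFinD.
by rewrite esumD ?lte_add_pinfty// => j _; rewrite lee_fin.
Qed.

Lemma abs_summableN g : abs_summable g -> abs_summable (fun j => - g j).
Proof. by move=> ag; apply: abs_summable_le ag => j; rewrite normrN. Qed.

Lemma esum_lt_pinftyZ g c : 0 <= c -> (forall j, 0 <= g j) ->
  (\esum_(j in [set: T]) (g j)%:E < +oo)%E ->
  (\esum_(j in [set: T]) (c * g j)%:E <=
   c%:E * \esum_(j in [set: T]) (g j)%:E)%E.
Proof.
move=> c0 g0 gf; apply: ub_ereal_sup => _ [A [finA _]] <-.
under eq_fsbigr do rewrite EFinM.
rewrite -ge0_mule_fsumr; last by move=> j; rewrite lee_fin.
apply: lee_wpmul2l; first by rewrite lee_fin.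
by apply: esum_ge; exists A.
Qed.

Lemma abs_summableZ g c : abs_summable g -> abs_summable (fun j => c * g j).
Proof.
move=> ag; apply: (@abs_summable_le _ (fun j => `|c| * `|g j|)).
  by move=> j; rewrite normrM.
apply: (le_lt_trans (esum_lt_pinftyZ _ _ ag)) => //.
by rewrite -(fineK (esum_fin_numP (fun j => normr_ge0 (g j)) ag)) -EFinM ltry.
Qed.

(** Any summable nonnegative splitting of g computes the sum, not only the positive and negative
    parts p and n: p + b = a + n holds termwise and all four sums are finite. Additivity follows by
    adding splittings. *)
Lemma signed_sum_sub g a b : (forall j, 0 <= a j) -> (forall j, 0 <= b j) ->
  (\esum_(j in [set: T]) (a j)%:E < +oo)%E ->
  (\esum_(j in [set: T]) (b j)%:E < +oo)%E ->
  (forall j, g j = a j - b j) ->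
  signed_sum g = fine (\esum_(j in [set: T]) (a j)%:E) -
                 fine (\esum_(j in [set: T]) (b j)%:E).
Proof.
move=> a0 b0 af bf gab.
pose p j := Num.max (g j) 0; pose n j := Num.max (- g j) 0.
have p0 j : 0 <= p j by rewrite le_max lexx orbT.
have n0 j : 0 <= n j by rewrite le_max lexx orbT.
have pf : (\esum_(j in [set: T]) (p j)%:E < +oo)%E.
  apply: le_lt_trans af; apply: le_esum => j _; rewrite lee_fin ge_max gab a0.
  by have := b0 j; lra.
have nf : (\esum_(j in [set: T]) (n j)%:E < +oo)%E.
  apply: le_lt_trans bf; apply: le_esum => j _; rewrite lee_fin ge_max gab b0.
  by have := a0 j; lra.
have e : (\esum_(j in [set: T]) (p j)%:E + \esum_(j in [set: T]) (b j)%:E =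
          \esum_(j in [set: T]) (a j)%:E + \esum_(j in [set: T]) (n j)%:E)%E.
  rewrite -!esumD; try by move=> j _; rewrite lee_fin.
  apply: eq_esum => j _; rewrite -!EFinD; congr _%:E.
  rewrite /p /n gab; case: (leP (a j - b j) 0) => ?;
    case: (leP (- (a j - b j)) 0) => ?; lra.
rewrite /signed_sum -/p -/n; move: e.
rewrite -(fineK (esum_fin_numP p0 pf)) -(fineK (esum_fin_numP n0 nf)).
rewrite -(fineK (esum_fin_numP a0 af)) -(fineK (esum_fin_numP b0 bf)).
rewrite -!EFinD => -[]; rewrite /p /n /=; lra.
Qed.

Lemma abs_summable_pos g : abs_summable g ->
  (\esum_(j in [set: T]) (Num.max (g j) 0)%:E < +oo)%E.
Proof.
apply: le_lt_trans; apply: le_esum => j _.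
by rewrite lee_fin ge_max normr_ge0 ler_norm.
Qed.

Lemma signed_sumD g h : abs_summable g -> abs_summable h ->
  signed_sum (fun j => g j + h j) = signed_sum g + signed_sum h.
Proof.
move=> ag ah.
have m0 (u : T -> R) j : 0 <= Num.max (u j) 0 by rewrite le_max lexx orbT.
have gp := abs_summable_pos ag; have hp := abs_summable_pos ah.
have gn := abs_summable_pos (abs_summableN ag).
have hn := abs_summable_pos (abs_summableN ah).
have D (a b : T -> R) : (forall j, 0 <= a j) -> (forall j, 0 <= b j) ->
    (\esum_(j in [set: T]) (a j)%:E < +oo)%E ->
    (\esum_(j in [set: T]) (b j)%:E < +oo)%E ->
    (\esum_(j in [set: T]) (a j + b j)%:E < +oo)%E /\
    fine (\esum_(j in [set: T]) (a j + b j)%:E) =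
    fine (\esum_(j in [set: T]) (a j)%:E) +
    fine (\esum_(j in [set: T]) (b j)%:E).
  move=> a0 b0 af bf.
  under eq_esum do rewrite EFinD.
  rewrite esumD; try by move=> j _; rewrite lee_fin.
  by rewrite lte_add_pinfty// fineD//; exact: esum_fin_numP.
have [P1 P2] := D _ _ (m0 g) (m0 h) gp hp.
have [N1 N2] := D _ _ (m0 (\- g)) (m0 (\- h)) gn hn.
rewrite (signed_sum_sub _ _ P1 N1); first by rewrite P2 N2 /signed_sum; lra.
- by move=> j; rewrite addr_ge0.
- by move=> j; rewrite addr_ge0.
- move=> j /=.
  case: (leP (g j) 0) => ?; case: (leP (h j) 0) => ?;
  case: (leP (- g j) 0) => ?; case: (leP (- h j) 0) => ?; lra.
Qed.

Lemma signed_sumN g : signed_sum (fun j => - g j) = - signed_sum g.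
Proof.
rewrite /signed_sum opprB; congr (_ - fine _).
by apply: eq_esum => j _; rewrite opprK.
Qed.

Lemma signed_sumB g h : abs_summable g -> abs_summable h ->
  signed_sum (fun j => g j - h j) = signed_sum g - signed_sum h.
Proof.
by move=> ag ah; rewrite signed_sumD ?signed_sumN//; exact: abs_summableN.
Qed.

Lemma signed_sum_ge0E g : (forall j, 0 <= g j) ->
  signed_sum g = fine (\esum_(j in [set: T]) (g j)%:E).
Proof.
move=> g0; rewrite /signed_sum [X in _ - fine X]esum1 ?subr0; last first.
  by move=> j _; rewrite max_r// oppr_le0.
by congr fine; apply: eq_esum => j _; rewrite max_l.
Qed.

Lemma signed_sum_ge0 g : (forall j, 0 <= g j) -> 0 <= signed_sum g.
Proof.
move=> g0; rewrite signed_sum_ge0E//; apply: fine_ge0.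
by apply: esum_ge0 => j _; rewrite lee_fin.
Qed.

Lemma le_signed_sum g h : abs_summable g -> abs_summable h ->
  (forall j, g j <= h j) -> signed_sum g <= signed_sum h.
Proof.
move=> ag ah gh; rewrite -subr_ge0 -signed_sumB//; apply: signed_sum_ge0 => j.
by rewrite subr_ge0.
Qed.

Lemma signed_sumZ g c : abs_summable g ->
  signed_sum (fun j => c * g j) = c * signed_sum g.
Proof.
move=> ag.
have le u a : 0 <= a -> (forall j, 0 <= u j) -> abs_summable u ->
    signed_sum (fun j => a * u j) <= a * signed_sum u.
  move=> a0 u0 au; have auj j : 0 <= a * u j by rewrite mulr_ge0.
  have uf : (\esum_(j in [set: T]) (u j)%:E < +oo)%E.
    by apply: le_lt_trans au; apply: le_esum => j _; rewrite lee_fin ler_norm.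
  have H := esum_lt_pinftyZ a0 u0 uf.
  have af : (\esum_(j in [set: T]) (a * u j)%:E < +oo)%E.
    apply: (le_lt_trans H).
    by rewrite -(fineK (esum_fin_numP u0 uf)) -EFinM ltry.
  rewrite !signed_sum_ge0E// -lee_fin EFinM.
  by rewrite (fineK (esum_fin_numP u0 uf)) (fineK (esum_fin_numP auj af)).
(* The reverse inequality is [le] for the factor a^-1 and the family a * u. *)
have eqp u a : 0 < a -> (forall j, 0 <= u j) -> abs_summable u ->
    signed_sum (fun j => a * u j) = a * signed_sum u.
  move=> a0 u0 au; apply/eqP; rewrite eq_le le ?(ltW a0)//=.
  have au0 j : 0 <= a * u j by rewrite mulr_ge0// ltW.
  have ia0 : 0 <= a^-1 by rewrite invr_ge0 ltW.
  have := le (fun j => a * u j) a^-1 ia0 au0 (abs_summableZ a au).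
  rewrite (_ : (fun j => a^-1 * (a * u j)) = u); last first.
    by apply/funext => j; rewrite mulKf ?gt_eqF.
  by rewrite ler_pdivlMl.
pose p j := Num.max (g j) 0; pose n j := Num.max (- g j) 0.
have p0 j : 0 <= p j by rewrite le_max lexx orbT.
have n0 j : 0 <= n j by rewrite le_max lexx orbT.
have ap : abs_summable p.
  by apply: abs_summable_le (abs_summable_pos ag) => j; rewrite ger0_norm.
have an : abs_summable n.
  apply: abs_summable_le (abs_summable_pos (abs_summableN ag)) => j.
  by rewrite ger0_norm.
have gpn j : g j = p j - n j.
  rewrite /p /n; case: (leP (g j) 0) => ?; case: (leP (- g j) 0) => ?; lra.
have {}eqp a : 0 < a -> signed_sum (fun j => a * g j) = a * signed_sum g.
  move=> a0; rewrite (_ : (fun j => a * g j) = fun j => a * p j - a * n j).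
    rewrite signed_sumB ?eqp//; try exact: abs_summableZ.
    rewrite -mulrBr -signed_sumB//; congr (_ * signed_sum _).
    by apply/funext => j; rewrite -gpn.
  by apply/funext => j; rewrite gpn mulrBr.
have [c0|c0|->] := ltgtP c 0; last 2 first.
- exact: eqp.
- rewrite mul0r signed_sum_ge0E ?esum1// => j *; by rewrite mul0r.
rewrite -[RHS]opprK -mulNr -eqp ?oppr_gt0// -signed_sumN.
by congr signed_sum; apply/funext => j; rewrite mulNr opprK.
Qed.

End SignedSum.

(** * Sums over sites weighted by occupation numbers *)

Section CountSum.
Variables (R : realType) (F : countType).
Implicit Types (g : F -> R) (s : seq F).

Lemma signed_sum_single (i : F) g :
  abs_summable (fun b => (b == i)%:R * g b) /\
  signed_sum (fun b => (b == i)%:R * g b) = g i.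
Proof.
have e (h : F -> R) : (forall b, 0 <= h b) ->
    (\esum_(b in [set: F]) ((b == i)%:R * h b)%:E)%E = (h i)%:E.
  move=> h0; rewrite -(@esum_set1 R F i (fun b => (h b)%:E)) ?lee_fin//.
  rewrite [RHS]esum_mkcond; apply: eq_esum => b _.
  by case: eqP => [->|bi]; rewrite ?mul1r ?mul0r; [rewrite mem_set|rewrite memNset].
split.
  apply: (@abs_summable_le _ _ _ (fun b => (b == i)%:R * `|g b|)).
    by move=> b; rewrite normrM ger0_norm.
  by rewrite e// ltry.
rewrite (@signed_sum_sub _ _ _ (fun b => (b == i)%:R * Num.max (g b) 0)
  (fun b => (b == i)%:R * Num.max (- g b) 0)).
- rewrite !e/=; try by move=> b; rewrite le_max lexx orbT.
  by case: (leP (g i) 0) => ?; case: (leP (- g i) 0) => ?; lra.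
- by move=> b; rewrite mulr_ge0// le_max lexx orbT.
- by move=> b; rewrite mulr_ge0// le_max lexx orbT.
- by rewrite e ?ltry// => b; rewrite le_max lexx orbT.
- by rewrite e ?ltry// => b; rewrite le_max lexx orbT.
- move=> b; rewrite -mulrBr; congr (_ * _).
  by case: (leP (g b) 0) => ?; case: (leP (- g b) 0) => ?; lra.
Qed.

(* A configuration is handled as the occupation numbers of a sequence listing
   the sites of the particles. *)
Definition cnt s : F -> nat := fun a => count_mem a s.

Lemma cnt_cons a s : cnt (a :: s) = fun b => ((b == a) + cnt s b)%N.
Proof. by apply/funext => b; rewrite /cnt /= eq_sym. Qed.

(** This turns a sum over all sites into a finite sum over particles. No bound on g is needed,
    because only finitely many sites are occupied. *)
Lemma signed_sum_cnt s g :
  abs_summable (fun b => (cnt s b)%:R * g b) /\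
  signed_sum (fun b => (cnt s b)%:R * g b) = \sum_(b <- s) g b.
Proof.
elim: s => [|a s [IH1 IH2]].
  have -> : (fun b => (cnt [::] b)%:R * g b) = fun=> 0.
    by apply/funext => b; rewrite /cnt mul0r.
  split; first by rewrite /abs_summable esum1// => b _; rewrite normr0.
  by rewrite big_nil signed_sum_ge0E// esum1.
have [S1 S2] := signed_sum_single a g.
have -> : (fun b => (cnt (a :: s) b)%:R * g b) =
    fun b => (b == a)%:R * g b + (cnt s b)%:R * g b.
  by apply/funext => b; rewrite cnt_cons natrD mulrDl.
by split; [exact: abs_summableD | rewrite signed_sumD// S2 IH2 big_cons].
Qed.

End CountSum.

(** * Stability of bounded functions *)

Section BoundedFunctions.
Variables (R : realType) (S : Type) (D : set S).
Implicit Types (f g : S -> R).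

Lemma bounded_on_cst (c : R) : bounded_on D (fun _ => c).
Proof. by exists `|c|. Qed.

Lemma bounded_on_lin (a : R) f g : bounded_on D f -> bounded_on D g ->
  bounded_on D (fun y => a * f y + g y).
Proof.
move=> [M hM] [M' hM']; exists (`|a| * M + M') => x Dx.
by rewrite (le_trans (ler_normD _ _))// normrM lerD ?ler_wpM2l ?hM ?hM'.
Qed.

Lemma bounded_onZ (a : R) f : bounded_on D f -> bounded_on D (fun y => a * f y).
Proof.
by move=> [M hM]; exists (`|a| * M) => x Dx; rewrite normrM ler_wpM2l ?hM.
Qed.

Lemma bounded_onM f g : bounded_on D f -> bounded_on D g ->
  bounded_on D (fun y => f y * g y).
Proof.
move=> [M hM] [M' hM']; exists (M * M') => x Dx.
by rewrite normrM ler_pM ?hM ?hM'.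
Qed.

Lemma bounded_onD f g : bounded_on D f -> bounded_on D g ->
  bounded_on D (fun y => f y + g y).
Proof.
move=> [M hM] [M' hM']; exists (M + M') => x Dx.
by rewrite (le_trans (ler_normD _ _))// lerD ?hM ?hM'.
Qed.

Lemma bounded_onN f : bounded_on D f -> bounded_on D (fun y => - f y).
Proof. by move=> [M hM]; exists M => x Dx; rewrite normrN hM. Qed.

Lemma bounded_onB f g : bounded_on D f -> bounded_on D g ->
  bounded_on D (fun y => f y - g y).
Proof. by move=> bf bg; apply: bounded_onD => //; exact: bounded_onN. Qed.

Lemma bounded_on_indic (x : S) : bounded_on D (fun y => (`[< y = x >])%:R : R).
Proof. by exists 1 => y _; case: asboolP => _; rewrite ?normr0 ?normr1. Qed.

End BoundedFunctions.

(** The passage to the limit in the number n+1 of time steps. The threshold [n0] leaves room for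
    estimates that require short steps. *)
Lemma ler_addharm (R : realType) (a b C : R) (n0 : nat) :
  (forall n, (n0 <= n)%N -> a <= b + C / n.+1%:R) -> a <= b.
Proof.
move=> h; apply/ler_addgt0Pr => e e0.
have C0 : 0 <= `|C| by [].
pose n := maxn n0 (Num.truncn (`|C| / e)).
have n1 : `|C| / e < n.+1%:R.
  apply: (lt_le_trans (truncnS_gt _)).
  by rewrite ler_nat ltnS leq_maxr.
apply: (le_trans (h n (leq_maxl _ _))); rewrite lerD2l.
rewrite ler_pdivrMr ?ltr0n//; apply: (le_trans (ler_norm _)).
by rewrite -ler_pdivrMl// mulrC ltW.
Qed.

(** * Contraction and covariance bounds for an abstract Markov semigroup *)

Section MarkovSemigroup.
Variables (R : realType) (S : Type) (D : set S).
Variables (T : R -> (S -> R) -> S -> R) (L : (S -> R) -> S -> R).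
Variables (adj : S -> S -> Prop) (q r rate : R).
Implicit Types (f g u v : S -> R) (h s t e K M : R) (x y : S).
Hypothesis T_lin : forall (t : R) a f g x, 0 <= t -> bounded_on D f ->
  bounded_on D g -> D x ->
  T t (fun y => a * f y + g y) x = a * T t f x + T t g x.
Hypothesis T_cst : forall (t c : R) x, 0 <= t -> D x -> T t (fun _ => c) x = c.
Hypothesis T_le : forall (t : R) f g x, 0 <= t -> bounded_on D f ->
  bounded_on D g -> D x -> (forall y, D y -> f y <= g y) -> T t f x <= T t g x.
Hypothesis T_add : forall (s t : R) f x, 0 <= s -> 0 <= t -> bounded_on D f ->
  D x -> T (s + t) f x = T s (T t f) x.
Hypothesis T_0 : forall f x, bounded_on D f -> D x -> T 0 f x = f x.
Hypothesis T_gen : forall f, bounded_on D f -> forall x, D x ->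
  (T t f x - f x) / t @[t --> 0^'+] --> L f x.
Hypothesis adjD : forall x y, adj x y -> D x /\ D y.
Hypothesis adj_sym : forall x y, adj x y -> adj y x.
Hypothesis q_ge0 : 0 <= q.
Hypothesis L_bound : forall f x (B : R), bounded_on D f -> D x -> 0 <= B ->
  (forall y, adj x y -> `|f y - f x| <= B) -> `|L f x| <= q * B.

(** One-sided is enough: [adj] is symmetric, so exchanging x and y bounds the absolute value. *)
Definition lip (K : R) f := forall x y, adj x y -> f x - f y <= K.

(** The explicit step 1 + h L is controlled for short steps only; [rate] sets the threshold and
    disappears from the conclusions as the number of steps grows. *)
Hypothesis L_lip : forall f (K : R) x y (h : R),
  bounded_on D f -> lip K f -> adj x y ->
  0 <= h -> h * rate <= 1 ->
  (f x + h * L f x) - (f y + h * L f y) <= (1 - r * h) * K.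

Lemma T_norm t f M x : 0 <= t -> (forall y, D y -> `|f y| <= M) -> D x ->
  `|T t f x| <= M.
Proof.
move=> t0 hM Dx; have bf : bounded_on D f by exists M.
rewrite ler_norml -{1}(T_cst (- M) t0 Dx) -[X in _ && (_ <= X)](T_cst M t0 Dx).
apply/andP; split; apply: T_le => //; try exact: bounded_on_cst.
- by move=> y Dy; have := hM _ Dy; rewrite ler_norml => /andP[].
- by move=> y Dy; have := hM _ Dy; rewrite ler_norml => /andP[].
Qed.

Lemma T_bounded t f : 0 <= t -> bounded_on D f -> bounded_on D (T t f).
Proof. by move=> t0 [M hM]; exists M => x Dx; exact: T_norm. Qed.

Lemma T_D t f g x : 0 <= t -> bounded_on D f -> bounded_on D g -> D x ->
  T t (fun y => f y + g y) x = T t f x + T t g x.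
Proof.
move=> t0 bf bg Dx; have := T_lin 1 t0 bf bg Dx; rewrite mul1r => <-.
by congr (T t _ x); apply/funext => y; rewrite mul1r.
Qed.

Lemma T_Z t a f x : 0 <= t -> bounded_on D f -> D x ->
  T t (fun y => a * f y) x = a * T t f x.
Proof.
move=> t0 bf Dx.
have := T_lin a t0 bf (bounded_on_cst D 0) Dx; rewrite T_cst// addr0 => <-.
by congr (T t _ x); apply/funext => y; rewrite addr0.
Qed.

Lemma T_B t f g x : 0 <= t -> bounded_on D f -> bounded_on D g -> D x ->
  T t (fun y => f y - g y) x = T t f x - T t g x.
Proof.
move=> t0 bf bg Dx; have := T_lin (-1) t0 bg bf Dx; rewrite mulN1r addrC => <-.
by congr (T t _ x); apply/funext => y; rewrite mulN1r addrC.
Qed.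

Lemma T_gen_near f x e : bounded_on D f -> D x -> 0 < e ->
  exists2 d, 0 < d & forall h, 0 < h < d ->
    `|T h f x - f x - h * L f x| <= e * h.
Proof.
move=> bf Dx e0; have /cvgrPdist_le/(_ e e0) := T_gen bf Dx.
rewrite /at_right near_withinE => -[d /= d0 hd].
exists d => // h /andP[h0 hlt].
have := hd h; rewrite /ball_/= sub0r normrN gtr0_norm// => /(_ hlt h0).
rewrite -(ler_pM2r h0); apply: le_trans.
have -> : T h f x - f x - h * L f x = - ((L f x - (T h f x - f x) / h) * h).
  by rewrite mulrBl divfK ?gt_eqF//; ring.
by rewrite normrN normrM (gtr0_norm h0).
Qed.

(* The probability of not having moved is supermultiplicative in time, so its
   derivative at 0 controls it for all times, uniformly in [x]. *)
Lemma T_stay t x : 0 <= t -> D x ->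
  1 - (q + 1) * t <= T t (fun y => (`[< y = x >])%:R) x.
Proof.
move=> t0 Dx; set f := (fun y => (`[< y = x >])%:R : R).
have bf : bounded_on D f := bounded_on_indic _ _ _.
have fx : f x = 1 by rewrite /f asboolT.
have f01 y : 0 <= f y <= 1.
  by rewrite /f; case: asboolP => _; rewrite lexx ler01.
have Tf0 s : 0 <= s -> 0 <= T s f x.
  move=> s0; rewrite -(T_cst 0 s0 Dx); apply: T_le => //.
  exact: bounded_on_cst.
(* As f is the indicator of x, [T s' f] dominates (T s' f x) f on [D]; apply [T s]. *)
have super s s' : 0 <= s -> 0 <= s' -> T s f x * T s' f x <= T (s + s') f x.
  move=> s0 s'0; rewrite T_add// mulrC -T_Z//; apply: T_le => //.
  - exact: bounded_onZ.
  - exact: T_bounded.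
  - move=> y Dy; rewrite /f; case: asboolP => [->|_]; rewrite ?mulr1// mulr0.
    rewrite -(T_cst 0 s'0 Dy); apply: T_le => //; exact: bounded_on_cst.
have [->|tn0] := eqVneq t 0; first by rewrite mulr0 subr0 T_0// fx.
have {tn0}t0' : 0 < t by rewrite lt_neqAle eq_sym tn0.
have q1 : 0 < q + 1 by rewrite ltr_wpDl.
(* The tolerance 1 chosen here is the +1 in q + 1. *)
have [d d0 hd] := T_gen_near bf Dx ltr01.
have Lf : - q <= L f x.
  have : `|L f x| <= q * 1.
    apply: L_bound => // y _; rewrite fx; have := f01 y; move/andP=> [a b].
    by rewrite ler_norml; apply/andP; split; lra.
  by rewrite mulr1 ler_norml => /andP[].
(* Enough steps that h is below d, where the derivative estimate holds, and that 1 - (q+1) h is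
   nonnegative, so that the lower bounds may be multiplied. *)
pose m := maxn (Num.truncn (t / d)) (Num.truncn (t * (q + 1))).
have m1 : t / d < m.+1%:R.
  by apply: (lt_le_trans (truncnS_gt _)); rewrite ler_nat ltnS leq_maxl.
have m2 : t * (q + 1) < m.+1%:R.
  by apply: (lt_le_trans (truncnS_gt _)); rewrite ler_nat ltnS leq_maxr.
have m0 : (0 : R) < m.+1%:R by rewrite ltr0n.
set h := t / m.+1%:R.
have h0 : 0 < h by rewrite divr_gt0.
have hltd : h < d by rewrite /h ltr_pdivrMr// mulrC -ltr_pdivrMr.
have hq : h * (q + 1) <= 1.
  by rewrite /h mulrAC ler_pdivrMr// mul1r ltW.
have step : 1 - (q + 1) * h <= T h f x.
  have := hd h; rewrite h0 hltd => /(_ isT); rewrite fx mul1r ler_norml.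
  move=> /andP[H _]; have : - q * h <= L f x * h by rewrite ler_pM2r.
  lra.
have iter n : 1 - n%:R * ((q + 1) * h) <= T (n%:R * h) f x.
  elim: n => [|n IH]; first by rewrite !mul0r subr0 T_0// fx.
  have nh : 0 <= n%:R * h by rewrite mulr_ge0// ltW.
  have -> : n.+1%:R * h = n%:R * h + h by rewrite -natr1; ring.
  apply: le_trans (super _ _ nh (ltW h0)).
  set a := (q + 1) * h in step *.
  have a0 : 0 <= a by rewrite mulr_ge0 ?ltW.
  have a1 : a <= 1 by rewrite /a mulrC.
  have n0 : (0 : R) <= n%:R by [].
  apply: (@le_trans _ _ (T (n%:R * h) f x * (1 - a))); last first.
    by rewrite ler_wpM2l ?Tf0.
  apply: (@le_trans _ _ ((1 - n%:R * a) * (1 - a))).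
    have : 0 <= n%:R * a * a by apply: mulr_ge0 => //; exact: mulr_ge0.
    by rewrite -natr1; lra.
  by rewrite ler_wpM2r// subr_ge0.
have -> : t = m.+1%:R * h by rewrite /h mulrCA divff ?mulr1// gt_eqF.
by apply: le_trans (iter _); rewrite mulrCA.
Qed.

Let k := q + 1.

(** The increment f - f x vanishes at x and is at most 2 M elsewhere, so it is dominated by 2 M
    times the indicator of having left x, to which [T_stay] applies. *)
Lemma T_near t f M x : 0 <= t -> (forall y, D y -> `|f y| <= M) -> D x ->
  `|T t f x - f x| <= 2 * M * (k * t).
Proof.
move=> t0 hM Dx; have bf : bounded_on D f by exists M.
have M0 : 0 <= M by apply: le_trans (hM _ Dx).
set e := fun y => (`[< y = x >])%:R : R.
have be : bounded_on D e := bounded_on_indic _ _ _.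
have bc (c : R) : bounded_on D (fun _ => c) := bounded_on_cst D c.
pose w y := 2 * M * (1 - e y).
have bw : bounded_on D w by apply: bounded_onZ; exact: bounded_onB.
have Tw : T t w x <= 2 * M * (k * t).
  rewrite /w T_Z//; last exact: bounded_onB.
  rewrite ler_wpM2l ?mulr_ge0// T_B// T_cst//.
  have := T_stay t0 Dx; rewrite -/e -/k; lra.
rewrite -[f x](T_cst _ t0 Dx) -T_B//.
have bfx : bounded_on D (fun y => f y - f x) by exact: bounded_onB.
have le y : D y -> `|f y - f x| <= w y.
  move=> Dy; rewrite /w /e; case: asboolP => [->|_].
    by rewrite !subrr normr0 mulr0.
  rewrite subr0 mulr1 (le_trans (ler_normB _ _))//.
  by have := hM _ Dx; have := hM _ Dy; lra.
apply: le_trans Tw; rewrite ler_norml; apply/andP; split.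
- rewrite lerNl -mulN1r -T_Z//; apply: T_le => //.
    by exists (2 * M) => y Dy; rewrite mulN1r normrN;
       apply: (le_trans (le _ Dy)); rewrite /w /e ler_piMr ?mulr_ge0//;
       case: asboolP => _; lra.
  by move=> y /le; rewrite ler_norml mulN1r => /andP[]; lra.
- by apply: T_le => // y /le; rewrite ler_norml => /andP[].
Qed.

(* [T h - 1] is a telescoping sum of [(T s - 1) T_(j s)] over [n] steps of
   length [s = h / n]; replacing [T_(j s) f] by [f] costs [O(h s)] per step, and
   [n (T s f - f)] tends to [h L f] at the given point. *)
Lemma T_expand h f M x : 0 <= h -> (forall y, D y -> `|f y| <= M) -> D x ->
  `|T h f x - f x - h * L f x| <= 4 * M * k ^+ 2 * h ^+ 2.
Proof.
move=> h0 hM Dx; have bf : bounded_on D f by exists M.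
have M0 : 0 <= M by apply: le_trans (hM _ Dx).
have k0 : 0 <= k by rewrite addr_ge0.
have [->|hn0] := eqVneq h 0.
  by rewrite T_0// subrr mul0r subrr normr0 expr0n mulr0.
have {hn0}hp : 0 < h by rewrite lt_neqAle eq_sym hn0.
apply/ler_addgt0Pr => e e0.
(* With tolerance e / h per unit of time, the steps of total length h cost e altogether. *)
have [d d0 hd] := T_gen_near bf Dx (divr_gt0 e0 hp).
pose n := Num.truncn (h / d).
have n0 : (0 : R) < n.+1%:R by rewrite ltr0n.
set s := h / n.+1%:R.
have s0 : 0 < s by rewrite divr_gt0.
have hs : h = n.+1%:R * s by rewrite /s mulrCA divff ?mulr1// gt_eqF.
have sd : s < d.
  by rewrite /s ltr_pdivrMr// mulrC -ltr_pdivrMr//; exact: truncnS_gt.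
have {}hd : `|T s f x - f x - s * L f x| <= e / h * s by apply: hd; rewrite s0.
have iter j : (j <= n.+1)%N ->
    `|T (j%:R * s) f x - f x - j%:R * (s * L f x)| <=
    j%:R * (4 * M * k ^+ 2 * h * s + e / h * s).
  elim: j => [_|j IH jn]; first by rewrite !mul0r T_0// subr0 subrr normr0.
  have js : 0 <= j%:R * s by rewrite mulr_ge0// ltW.
  have {}IH := IH (ltnW jn).
  rewrite -natr1 [(j%:R + 1) * s]mulrDl mul1r.
  rewrite [j%:R * s + s]addrC T_add// ?(ltW s0)//.
  set g := T (j%:R * s) f in IH *.
  have bg : bounded_on D g by exact: T_bounded.
  pose u y := g y - f y.
  (* [T_near] is used twice, here over a time at most h and below for [u] over the time s; together
     they give the 4 M k^2 h s charged to each step. *)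
  have hu y : D y -> `|u y| <= 2 * M * (k * h).
    move=> Dy; apply: (le_trans (T_near js hM Dy)).
    rewrite ler_wpM2l ?mulr_ge0// ler_wpM2l//.
    by rewrite [leRHS]hs ler_wpM2r ?(ltW s0)// ler_nat ltnW.
  have := T_near (ltW s0) hu Dx; rewrite /u T_B ?(ltW s0)// => Hu.
  rewrite (_ : _ - _ = (T s g x - T s f x - (g x - f x)) +
    (T s f x - f x - s * L f x) + (g x - f x - j%:R * (s * L f x))); last by ring.
  rewrite mulrDl mul1r [leRHS]addrC.
  apply: (le_trans (ler_normD _ _)); apply: lerD => //.
  apply: (le_trans (ler_normD _ _)); apply: lerD => //.
  by apply: (le_trans Hu); rewrite le_eqVlt; apply/orP; left; apply/eqP; ring.
have := iter _ (leqnn _); rewrite mulrA -hs => /le_trans; apply.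
rewrite le_eqVlt; apply/orP; left; apply/eqP.
have -> : n.+1%:R * (4 * M * k ^+ 2 * h * s + e / h * s) =
  4 * M * k ^+ 2 * h * (n.+1%:R * s) + e / h * (n.+1%:R * s) by ring.
by rewrite -hs divfK ?gt_eqF//; ring.
Qed.

(** The 8 is twice the 4 of [T_expand], which is used at both ends of the adjacent pair. *)
Lemma lip_step h f M K : 0 <= h -> h * rate <= 1 ->
  (forall y, D y -> `|f y| <= M) -> lip K f ->
  lip ((1 - r * h) * K + 8 * M * k ^+ 2 * h ^+ 2) (T h f).
Proof.
move=> h0 hr hM lf x y xy; have [Dx Dy] := adjD xy.
have bf : bounded_on D f by exists M.
have := T_expand h0 hM Dx; have := T_expand h0 hM Dy.
have := L_lip bf lf xy h0 hr; rewrite !ler_norml => ? /andP[? ?] /andP[? ?].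
lra.
Qed.

Lemma lip_exp t f M K : 0 <= t -> (forall y, D y -> `|f y| <= M) ->
  0 <= K -> lip K f -> lip (expR (- (r * t)) * K) (T t f).
Proof.
move=> t0 hM K0 lf x y xy; have [Dx Dy] := adjD xy.
have M0 : 0 <= M by apply: le_trans (hM _ Dx).
have bf : bounded_on D f by exists M.
have k0 : 0 <= k by rewrite addr_ge0.
pose c := 8 * M * k ^+ 2.
have c0 : 0 <= c by rewrite !mulr_ge0.
(* Since r may be negative, errors of early steps can be amplified later, by at most this factor;
   n+1 errors of size c h^2 then total c t^2 E / (n+1). *)
pose E := expR (`|r| * t).
apply: (@ler_addharm _ _ _ (c * t ^+ 2 * E) (Num.truncn (t * rate))) => n hn.
have n0 : (0 : R) < n.+1%:R by rewrite ltr0n.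
set h := t / n.+1%:R.
have h0 : 0 <= h by rewrite divr_ge0.
have hs : t = n.+1%:R * h by rewrite /h mulrCA divff ?mulr1// gt_eqF.
have hr : h * rate <= 1.
  rewrite /h mulrAC ler_pdivrMr// mul1r; apply: (le_trans (ltW (truncnS_gt _))).
  by rewrite ler_nat ltnS.
have iter j : (j <= n.+1)%N ->
    lip (expR (- (r * (j%:R * h))) * K +
         j%:R * (c * h ^+ 2 * expR (`|r| * (j%:R * h))))
      (T (j%:R * h) f).
  elim: j => [_|j IH jn].
    move=> a b ab; have [Da Db] := adjD ab.
    by rewrite !mul0r mulr0 oppr0 expR0 mul1r addr0 !T_0//; exact: lf.
  have js : 0 <= j%:R * h by rewrite mulr_ge0.
  have hg z : D z -> `|T (j%:R * h) f z| <= M by exact: T_norm.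
  have := lip_step h0 hr hg (IH (ltnW jn)).
  set Kj := (X in (1 - r * h) * X) => H a b ab; have [Da Db] := adjD ab.
  rewrite -natr1 [(j%:R + 1) * h]mulrDl mul1r.
  rewrite [j%:R * h + h]addrC !T_add//; apply: (le_trans (H _ _ ab)).
  have Kj0 : 0 <= Kj.
    rewrite /Kj addr_ge0// mulr_ge0// ?expR_ge0// mulr_ge0 ?expR_ge0//.
    by rewrite mulr_ge0 ?exprn_ge0.
  have e1 : (1 - r * h) * Kj <= expR (- (r * h)) * Kj.
    by rewrite ler_wpM2r// expR_ge1Dx.
  apply: (@le_trans _ _ (expR (- (r * h)) * Kj + c * h ^+ 2)).
    by rewrite lerD2r.
  rewrite /Kj mulrDr mulrA -expRD -opprD -mulrDr -addrA lerD2l.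
  rewrite [(j%:R + 1) * _]mulrDl mul1r; apply: lerD; last first.
    rewrite ler_peMr ?mulr_ge0 ?exprn_ge0// -[leLHS](expR0 R) ler_expR.
    by rewrite mulr_ge0// addr_ge0.
  rewrite mulrCA ler_wpM2l// mulrCA ler_wpM2l ?mulr_ge0 ?exprn_ge0//.
  rewrite -expRD ler_expR mulrDr lerD2r.
  by rewrite -mulNr ler_wpM2r// -normrN ler_norm.
have := iter _ (leqnn _) _ _ xy; rewrite -hs => /le_trans; apply.
rewrite lerD2l /E [leRHS](_ : _ = c * h * (n.+1%:R * h) * expR (`|r| * t)).
  by rewrite le_eqVlt; apply/orP; left; apply/eqP; ring.
by rewrite -hs /h; ring.
Qed.

Definition cov t f g x := T t (fun y => f y * g y) x - T t f x * T t g x.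

Lemma covD h t f g x : 0 <= h -> 0 <= t -> bounded_on D f -> bounded_on D g ->
  D x -> cov (h + t) f g x = T h (cov t f g) x + cov h (T t f) (T t g) x.
Proof.
move=> h0 t0 bf bg Dx.
have bT u : bounded_on D u -> bounded_on D (T t u) by exact: T_bounded.
have bfg : bounded_on D (fun y => f y * g y) by exact: bounded_onM.
rewrite /cov T_B//; [|exact: bT|by apply: bounded_onM; exact: bT].
rewrite !T_add//; lra.
Qed.

(** Centring u and v at their values in x gives a product [w] that vanishes at x and is at most K^2
    on the neighbours of x, so |L w x| <= q K^2. The 20 is 16 + 4: the error of [T_expand] for [w],
    bounded by 4, plus the product of two displacements from [T_near]. *)
Lemma cov_small h u v K x : 0 <= h -> D x -> 0 <= K ->
  (forall y, D y -> `|u y| <= 1) -> (forall y, D y -> `|v y| <= 1) ->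
  lip K u -> lip K v ->
  `|cov h u v x| <= h * (q * K ^+ 2) + 20 * k ^+ 2 * h ^+ 2.
Proof.
move=> h0 Dx K0 hu hv lu lv.
have bu : bounded_on D u by exists 1.
have bv : bounded_on D v by exists 1.
pose w y := (u y - u x) * (v y - v x).
have hw y : D y -> `|w y| <= 4.
  move=> Dy; rewrite normrM (_ : 4 = (1 + 1) * (1 + 1)); last by ring.
  by apply: ler_pM => //; rewrite (le_trans (ler_normB _ _))// lerD ?hu ?hv.
have bw : bounded_on D w by exists 4.
have wx : w x = 0 by rewrite /w subrr mul0r.
have Lw : `|L w x| <= q * K ^+ 2.
  apply: L_bound => //; first exact: exprn_ge0.
  move=> y xy; rewrite wx subr0 normrM expr2.
  by apply: ler_pM => //; rewrite ler_norml; apply/andP; split;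
    [have := lu _ _ xy | have := lu _ _ (adj_sym xy)
    |have := lv _ _ xy | have := lv _ _ (adj_sym xy)]; lra.
have bc (c : R) : bounded_on D (fun _ => c) := bounded_on_cst D c.
have buv : bounded_on D (fun y => u y * v y) by exact: bounded_onM.
have Tw : T h w x = T h (fun y => u y * v y) x - u x * T h v x - v x * T h u x
    + u x * v x.
  have b1 := bounded_on_lin (- v x) bu (bc (u x * v x)).
  have b2 := bounded_on_lin (- u x) bv b1.
  rewrite (_ : w = fun y =>
      u y * v y + ((- u x) * v y + ((- v x) * u y + u x * v x))).
    rewrite T_D//.
    have -> := T_lin (- u x) h0 bv b1 Dx.
    have -> := T_lin (- v x) h0 bu (bc (u x * v x)) Dx.
    by rewrite T_cst//; ring.
  by apply/funext => y; rewrite /w; ring.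
have -> : cov h u v x = T h w x - (T h u x - u x) * (T h v x - v x).
  by rewrite Tw /cov; ring.
have := T_expand h0 hw Dx; rewrite wx subr0 => Ew.
have Eu := T_near h0 hu Dx; have Ev := T_near h0 hv Dx.
have Euv : `|(T h u x - u x) * (T h v x - v x)| <= 4 * k ^+ 2 * h ^+ 2.
  rewrite normrM (_ : 4 * k ^+ 2 * h ^+ 2 =
    2 * 1 * (k * h) * (2 * 1 * (k * h))); last by ring.
  exact: ler_pM.
have hLw : `|h * L w x| <= h * (q * K ^+ 2).
  by rewrite normrM ger0_norm// ler_wpM2l.
move: Ew Euv hLw; rewrite !ler_norml => /andP[? ?] /andP[? ?] /andP[? ?].
apply/andP; split; lra.
Qed.

Lemma cov_lip t f g K x : 0 <= t -> D x -> 0 <= K ->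
  (forall y, D y -> `|f y| <= 1) -> (forall y, D y -> `|g y| <= 1) ->
  lip K f -> lip K g ->
  `|cov t f g x| <= q * K ^+ 2 * decay r%:E t.
Proof.
move=> t0 Dx K0 hf hg lf lg.
have bf : bounded_on D f by exists 1.
have bg : bounded_on D g by exists 1.
have bfg : bounded_on D (fun y => f y * g y) by exact: bounded_onM.
have k0 : 0 <= k by rewrite addr_ge0.
apply: (@ler_addharm _ _ _ (20 * k ^+ 2 * t ^+ 2)
  (Num.truncn (t * (2 * `|r|)))) => n hn.
have n0 : (0 : R) < n.+1%:R by rewrite ltr0n.
set h := t / n.+1%:R.
have h0 : 0 <= h by rewrite divr_ge0.
have hs : t = n.+1%:R * h by rewrite /h mulrCA divff ?mulr1// gt_eqF.
have hr : h * (2 * `|r|) <= 1.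
  rewrite /h mulrAC ler_pdivrMr// mul1r; apply: (le_trans (ltW (truncnS_gt _))).
  by rewrite ler_nat ltnS.
(* [decay] at s is twice the integral of exp (- 2 r u) over [0, s]. The factor 2 leaves room for the
   left-endpoint value of the integrand, although it overestimates the integral over a step when r >
   0; there 2 r h <= 1 is used. *)
have decayS s : h * expR (- (r * s)) ^+ 2 + decay r%:E s <= decay r%:E (h + s).
  rewrite /decay; case: eqP => [->|/eqP r0].
    by rewrite mul0r oppr0 expR0 expr1n mulr1 mulrDr; lra.
  have e2 : expR (- (r * s)) ^+ 2 = expR (- (2 * r * s)).
    by rewrite expr2 -expRD; congr expR; ring.
  rewrite e2 -lerBrDr -mulrBl.
  rewrite (_ : _ - _ = expR (- (2 * r * s)) * (1 - expR (- (2 * r * h)))); last first.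
    by rewrite mulrDr opprD expRD; ring.
  rewrite [leLHS]mulrC -[leRHS]mulrA ler_wpM2l ?expR_ge0//.
  have [rp|rn] := ltP 0 r.
    rewrite ler_pdivlMr//.
    set z := 2 * r * h.
    have z0 : 0 <= z by rewrite /z !mulr_ge0// ltW.
    have z1 : z <= 1 by move: hr; rewrite gtr0_norm// mulrC.
    (* It follows that 1 - exp (- z) >= z / (1 + z) >= z / 2, as z <= 1. *)
    have E : expR (- z) * (1 + z) <= 1.
      rewrite expRN mulrC ler_pdivrMr ?expR_gt0// mul1r.
      exact: expR_ge1Dx.
    rewrite (_ : h * r = z / 2); last by rewrite /z; field.
    by have [?|?] := lerP 2^-1 (expR (- z)); nra.
  have {}rn : r < 0 by rewrite lt_neqAle r0.
  rewrite ler_ndivlMr//.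
  have := expR_ge1Dx (- (2 * r * h)).
  have : h * r <= 0 by rewrite mulr_ge0_le0// ltW.
  nra.
have iter j : (j <= n.+1)%N -> forall y, D y ->
    `|cov (j%:R * h) f g y| <= q * K ^+ 2 * decay r%:E (j%:R * h)
      + j%:R * (20 * k ^+ 2 * h ^+ 2).
  elim: j => [_|j IH jn] y Dy.
    rewrite !mul0r /cov !T_0// subrr normr0 addr0 /decay; case: eqP => _.
      by rewrite !mulr0.
    by rewrite mulr0 oppr0 expR0 subrr mul0r mulr0.
  have js : 0 <= j%:R * h by rewrite mulr_ge0.
  rewrite -natr1 [(j%:R + 1) * h]mulrDl mul1r [j%:R * h + h]addrC covD//.
  have H1 := T_norm h0 (IH (ltnW jn)) Dy.
  have H2 := cov_small h0 Dy (mulr_ge0 (expR_ge0 _) K0)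
    (fun z => T_norm js hf) (fun z => T_norm js hg)
    (lip_exp js hf K0 lf) (lip_exp js hg K0 lg).
  apply: (le_trans (ler_normD _ _)); apply: (le_trans (lerD H1 H2)).
  have := ler_wpM2l (mulr_ge0 q_ge0 (exprn_ge0 2 K0)) (decayS (j%:R * h)).
  rewrite [(_ * K) ^+ 2]exprMn; lra.
have := iter _ (leqnn _) _ Dx; rewrite -hs => /le_trans; apply.
rewrite lerD2l [leLHS](_ : _ = 20 * k ^+ 2 * h * (n.+1%:R * h)); last by ring.
by rewrite -hs /h le_eqVlt; apply/orP; left; apply/eqP; ring.
Qed.

End MarkovSemigroup.

(** * The transition semigroup of a process with countable state space *)

Section SemigroupOfProcess.
Variables (R : realType) (S : choiceType) (D : set S).
Variables (d : measure_display) (Omega : measurableType d).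
Variables (P : S -> probability Omega R) (X : R -> Omega -> S).
Implicit Types (f g : S -> R) (s t : R) (x y : S).
Hypothesis markovX : markov_process D P X.
Hypothesis countD : countable D.

Definition semigroup t f x : R := \int[P x]_w f (X t w).

Lemma semigroupE t f x : fine 'E_(P x)[f \o X t]%E = semigroup t f x.
Proof. by rewrite unlock. Qed.

Lemma measurable_X t f : 0 <= t ->
  measurable_fun [set: Omega] (fun w => f (X t w)).
Proof.
move=> t0 _ B mB; rewrite setTI.
have [_ mX _ _] := markovX.
exact: (mX t (f @^-1` B)).
Qed.

Lemma measurable_EX t f : 0 <= t ->
  measurable_fun [set: Omega] (EFin \o (fun w => f (X t w))).
Proof.
by move=> t0; apply/measurable_EFinP; exact: (measurable_X f t0).
Qed.

Lemma integrable_X t f x : 0 <= t -> bounded_on D f ->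
  (P x).-integrable [set: Omega] (EFin \o (fun w => f (X t w))).
Proof.
move=> t0 [M hM]; have [XD _ _ _] := markovX.
apply: measurable_bounded_integrable => //.
- exact: (le_lt_trans (probability_le1 _ measurableT) (ltry _)).
- exact: (measurable_X f t0).
- exists M; split; first exact: num_real.
  by move=> y My w _; apply: (le_trans (hM _ (XD _ _ t0))); exact: ltW.
Qed.

Lemma semigroup_lin t a f g x : 0 <= t -> bounded_on D f -> bounded_on D g ->
  semigroup t (fun y => a * f y + g y) x = a * semigroup t f x + semigroup t g x.
Proof.
move=> t0 bf bg; rewrite /semigroup RintegralD//.
- by rewrite RintegralZl//; exact: integrable_X.
- by apply: (integrable_X x t0 (f := fun y => a * f y)); exact: bounded_onZ.
- exact: integrable_X.
Qed.

Lemma semigroup_cst t c x : semigroup t (fun _ => c) x = c.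
Proof.
rewrite /semigroup Rintegral_cst// (_ : fine _ = 1) ?mulr1//.
exact: (congr1 fine (probability_setT (P x))).
 Qed.

Lemma semigroup_le t f g x : 0 <= t -> bounded_on D f -> bounded_on D g ->
  (forall y, D y -> f y <= g y) -> semigroup t f x <= semigroup t g x.
Proof.
move=> t0 bf bg fg; have [XD _ _ _] := markovX.
by apply: le_Rintegral; rewrite //; try exact: integrable_X;
  move=> w _; apply: fg; exact: XD.
Qed.

Lemma semigroup_0 f x : bounded_on D f -> D x -> semigroup 0 f x = f x.
Proof.
move=> bf Dx; have [_ mX X0 _] := markovX.
have m1 : measurable (X 0 @^-1` [set x]) by exact: mX.
rewrite /semigroup /Rintegral.
rewrite (@ae_eq_integral _ _ _ (P x) setT (fun _ => (f x)%:E)) //.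
- transitivity (fine ((f x)%:E * 1)%E); last by rewrite mule1.
  by rewrite integral_cst//; congr (fine (_ * _)%E); exact: probability_setT.
- exact: (measurable_EX f).
- exists (~` (X 0 @^-1` [set x])); split.
  + exact: measurableC.
  + transitivity (1 - P x (X 0 @^-1` [set x]))%E; first exact: probability_setC.
    have -> : P x (X 0 @^-1` [set x]) = 1%E by exact: X0.
    by rewrite subee.
  + move=> w /=; apply: contra_not => e _ /=.
    by rewrite e.
Qed.

(** The Markov property speaks of single states, so integrals are cut along the value of [X t],
    coded by [phi] and decoded by [psi]; on each piece the integrand is constant. *)
Lemma partition_integral t (mu : probability Omega R) (E : set Omega) f
  (phi : S -> nat) (psi : nat -> S) : 0 <= t -> measurable E ->
  (forall y, D y -> psi (phi y) = y) -> (forall y, 0 <= f y) ->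
  (\int[mu]_(w in E) (f (X t w))%:E =
   \sum_(0 <= n <oo)
     ((f (psi n))%:E * mu (E `&` (X t @^-1` (phi @^-1` [set n])))))%E.
Proof.
move=> t0 mE psiK f0; have [XD mX _ _] := markovX.
pose B n := E `&` (X t @^-1` (phi @^-1` [set n])).
have mB n : measurable (B n) by apply: measurableI => //; exact: mX.
have EB : E = \bigcup_n B n.
  apply/seteqP; split=> [w Ew|w [n _ []]//].
  by exists (phi (X t w)).
have tB : trivIset setT B.
  by move=> i j _ _ [w [[_ /= <-] [_ /= <-]]].
rewrite {1}EB ge0_integral_bigcup//; last 2 first.
- apply: (@measurable_funS _ _ _ _ setT) => //.
  by exact: (measurable_EX f).
- by move=> w _; rewrite lee_fin.
apply: eq_eseriesr => n _; rewrite -integral_cst; last exact: mB.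
apply: eq_integral => w; rewrite inE => -[_ /= <-].
by rewrite psiK//; exact: XD.
Qed.

Lemma semigroup_add s t f x : 0 <= s -> 0 <= t -> bounded_on D f -> D x ->
  semigroup (s + t) f x = semigroup s (semigroup t f) x.
Proof.
move=> s0 t0; wlog f0 : f / forall y, 0 <= f y.
  move=> H bf Dx; have [M hM] := bf.
  (* [partition_integral] asks for f >= 0 everywhere, so f is shifted by its bound on [D]; the
     truncation alters values only off [D], where the process never is. *)
  pose g y := Num.max (f y + M) 0.
  have fg y : D y -> f y = g y - M.
    move=> Dy; rewrite /g max_l ?addrK//.
    by have := hM _ Dy; rewrite ler_norml => /andP[]; lra.
  have bg : bounded_on D g.
    have [C hC] := bounded_onD bf (bounded_on_cst D M).
    exists C => y Dy; apply: le_trans (hC _ Dy).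
    rewrite /g; case: (leP (f y + M) 0) => // _; by rewrite normr0.
  have bM := bounded_on_cst D (- M).
  have st0 : 0 <= s + t by rewrite addr_ge0.
  have E u h y : 0 <= u -> bounded_on D h -> (forall z, D z -> f z = h z) ->
      semigroup u f y = semigroup u h y.
    move=> u0 bh fh; apply/eqP; rewrite eq_le.
    by rewrite !semigroup_le// => z /fh ->.
  have L u y : 0 <= u -> semigroup u f y = semigroup u g y - M.
    move=> u0; rewrite (E _ (fun z => 1 * g z + - M))//.
    - by rewrite semigroup_lin// semigroup_cst mul1r.
    - exact: bounded_on_lin.
    - by move=> z /fg ->; rewrite mul1r.
  rewrite L// H//; last by move=> y; rewrite le_max lexx orbT.
  rewrite (_ : semigroup t f = fun y => 1 * semigroup t g y + - M).
    rewrite semigroup_lin// ?semigroup_cst ?mul1r//.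
    have [C hC] := bg; exists C => y Dy.
    rewrite -(semigroup_cst t C y) ler_norml; apply/andP; split.
      rewrite lerNl -[leLHS]mulN1r -[leLHS]addr0 -(semigroup_cst t 0 y).
      rewrite -semigroup_lin//; last exact: bounded_on_cst.
      apply: semigroup_le => //; try exact: bounded_on_cst.
        by apply: bounded_on_lin => //; exact: bounded_on_cst.
      by move=> z /hC; rewrite ler_norml => /andP[? ?]; lra.
    apply: semigroup_le => //; first exact: bounded_on_cst.
    by move=> z /hC; rewrite ler_norml => /andP[? ?]; lra.
  by apply/funext => y; rewrite L// mul1r.
move=> bf Dx; have [XD mX _ mk] := markovX.
have /countable_injP[phi phi_inj] := countD.
(* Codes borne by no state of [D] decode to the starting point x, so every [psi n] lies in [D], as
   the Markov property requires. *)
pose psi n : S := xget x [set y | D y /\ phi y = n].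
have psiD n : D (psi n) by rewrite /psi; case: xgetP => [y _ []|].
have psiK y : D y -> psi (phi y) = y.
  move=> Dy; rewrite /psi; case: xgetP => [z _ [Dz]|/(_ y)]; last by case.
  by move=> /phi_inj; apply; rewrite inE.
have st0 : 0 <= s + t by rewrite addr_ge0.
pose B n := X s @^-1` (phi @^-1` [set n]).
have mB n : measurable (B n) by exact: mX.
have semiE y : (semigroup t f y)%:E = (\int[P y]_w (f (X t w))%:E)%E.
  by rewrite /semigroup fineK//; apply: integrable_fin_num => //; exact: integrable_X.
have fineE u h y : semigroup u h y = fine (\int[P y]_w (h (X u w))%:E)%E by [].
rewrite (fineE (s + t) f) (fineE s (semigroup t f)); congr fine.
have TB : [set: Omega] = \bigcup_n B n.
  by apply/seteqP; split=> // w _; exists (phi (X s w)).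
have tB : trivIset setT B.
  by move=> i j _ _ [w [/= <- /= <-]].
rewrite {1}TB ge0_integral_bigcup//; last 2 first.
- apply: (@measurable_funS _ _ _ _ setT) => //.
  by exact: (measurable_EX f).
- by move=> w _; rewrite lee_fin.
rewrite (@partition_integral s (P x) setT _ phi psi)//; last first.
  move=> y; rewrite -(semigroup_cst t 0 y); apply: semigroup_le => //.
  exact: bounded_on_cst.
apply: eq_eseriesr => n _; rewrite setTI -/(B n).
(* An empty piece contributes 0 to both sides; a nonempty one is exactly the event that [X s] equals
   [psi n]. *)
have [[w0 Bw0]|B0] := pselect (exists w, B n w); last first.
  rewrite (_ : B n = set0) ?integral_set0 ?measure0 ?mule0//.
  by apply/seteqP; split => // w Bw; apply: B0; exists w.
have phipsi : phi (psi n) = n by rewrite -Bw0 psiK//; exact: XD.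
have Beq : B n = [set w | X s w = psi n].
  apply/seteqP; split => w /=; last by move=> e; rewrite /B /= e.
  by rewrite /B /= => <-; rewrite psiK//; exact: XD.
rewrite semiE (@partition_integral t (P (psi n)) setT _ phi psi)//.
rewrite (@partition_integral _ (P x) (B n) _ phi psi)//.
rewrite muleC -(fineK (fin_num_measure (P x) _ (mB n))) -nneseriesZl; last first.
  by move=> i _; rewrite mule_ge0// lee_fin.
apply: eq_eseriesr => m _; rewrite fineK ?fin_num_measure// setTI.
rewrite muleCA; congr (_ * _)%E.
(* Chapman-Kolmogorov needs only the trivial past event. *)
have pT : past X s setT.
  by apply: sub_sigma_algebra; exists 0, setT; rewrite lexx s0 preimage_setT.
have := mk x s t (psi n) setT (phi @^-1` [set m]) Dx (psiD n) s0 t0 pT.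
by rewrite setTI -Beq.
Qed.

End SemigroupOfProcess.

(** * Configurations as lists of particle sites *)

Section Configurations.
Variables (R : realType) (F : countType).
Implicit Types (s : seq F) (eta : F -> nat) (a b : F).

Lemma cnt_perm s s' : perm_eq s s' -> cnt s = cnt s'.
Proof. by move=> /permP ss'; apply/funext => a; exact: ss'. Qed.

Lemma move_cnt s a b : a \in s -> move a b (cnt s) = cnt (b :: rem a s).
Proof.
move=> sa; rewrite (cnt_perm (perm_to_rem sa)) !cnt_cons /move.
by apply/funext => k; rewrite addKn addnC.
Qed.

Lemma rem_cons_perm i s a : a \in s ->
  perm_eq (rem a (i :: s)) (i :: rem a s).
Proof. by move=> sa /=; case: eqP => [->|]//; exact: perm_to_rem. Qed.

Lemma configs_cnt s : configs R (size s) (cnt s).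
Proof.
have [h1 h2] := signed_sum_cnt s (fun _ => 1 : R).
have e : (fun b => (cnt s b)%:R * 1) = (fun b => (cnt s b)%:R : R).
  by apply/funext => b; rewrite mulr1.
move: h1 h2; rewrite e /abs_summable /configs /= => h1.
rewrite signed_sum_ge0E// big_const_seq count_predT iter_addr_0 => <-.
rewrite fineK//; apply: esum_fin_numP => //; apply: le_lt_trans h1.
by apply: le_esum => j _; rewrite lee_fin ler_norm.
Qed.

(** Induction on the number of particles: a positive total forces an occupied site, and one particle
    is removed there. *)
Lemma configsP n eta : configs R n eta -> exists2 s, size s = n & eta = cnt s.
Proof.
elim: n eta => [|n IH] eta; rewrite /configs /= => hs.
  exists [::] => //; apply/funext => a; rewrite /cnt /=.
  have : ((eta a)%:R%:E <= \esum_(i in [set: F]) ((eta i)%:R : R)%:E)%E.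
    apply: esum_ge; exists [set a]; first by split.
    by rewrite fsbig_set1.
  by rewrite hs lee_fin lern0 => /eqP.
have [i ei] : exists i, (0 < eta i)%N.
  apply: contrapT => /forallNP e0.
  move: hs; rewrite esum1; last first.
    by move=> j _; have := e0 j; rewrite lt0n => /negP; rewrite negbK => /eqP ->.
  by move=> [] /eqP; rewrite eq_sym pnatr_eq0.
pose eta' b := (eta b - (b == i))%N.
have ee : eta = fun b => ((b == i) + eta' b)%N.
  apply/funext => b; rewrite /eta'; case: eqP => [->|_]; last by rewrite subn0.
  by rewrite subnKC.
have [|s sn e's] := IH eta'; last first.
  by exists (i :: s); rewrite /= ?sn// cnt_cons -e's.
rewrite /configs /=; move: hs; rewrite {1}ee.
under eq_esum do rewrite natrD EFinD.
rewrite esumD; try by move=> b _; rewrite lee_fin.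
have [S1 S2] := signed_sum_single i (fun _ => 1 : R).
rewrite (_ : (\esum_(b in [set: F]) (b == i)%:R%:E)%E = 1%:E); last first.
  have e : (fun b => (b == i)%:R * 1) = (fun b => (b == i)%:R : R).
    by apply/funext => b; rewrite mulr1.
  move: S1 S2; rewrite e signed_sum_ge0E// => S1 S2.
  rewrite -[LHS]fineK ?S2//; apply: esum_fin_numP => //; apply: le_lt_trans S1.
  by apply: le_esum => j _; rewrite lee_fin ler_norm.
rewrite -natr1 [_ + 1%R]addrC EFinD => h.
have := congr1 (fun x => ((- 1)%R%:E + x)%E) h => /=.
by rewrite !addeA -EFinD addNr !add0e.
Qed.

Lemma countable_configs n : countable (configs R n : set (F -> nat)).
Proof.
apply: (@sub_countable _ _ _ [set: seq F]) => //.
apply: card_le_trans (card_image_le (@cnt F) _).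
by apply: subset_card_le => eta /configsP[s _ ->]; exists s.
Qed.

Lemma sumr_le_const s (X : F -> R) (C : R) : (forall a, a \in s -> X a <= C) ->
  \sum_(a <- s) X a <= (size s)%:R * C.
Proof.
move=> XC; rewrite mulr_natl -iter_addr_0 -(count_predT s) -big_const_seq.
by rewrite big_seq [leRHS]big_seq; apply: ler_sum => a /XC.
Qed.

End Configurations.

(** * Size of the generator and the coupling estimate *)

Section FlemingViotGenerator.
Variables (R : realType) (F : countType) (Q : F -> F -> R) (p0 : F -> R).
Variables (N : nat) (q1 pb ib lam : R).
Hypothesis rateQ : rate_matrix Q.
Hypothesis p0_ge0 : forall i, 0 <= p0 i.
Hypothesis N_ge2 : (2 <= N)%N.
Hypothesis Q1_le : (Q1 Q <= q1%:E)%E.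
Hypothesis sup_le : (sup_death p0 <= pb%:E)%E.
Hypothesis le_inf : (ib%:E <= inf_death p0)%E.
Hypothesis le_lambda : (lam%:E <= lambda Q)%E.
Implicit Types (f : (F -> nat) -> R) (s : seq F) (g : F -> R) (a b i : F).

Let D := @configs R F N.

Let p0_le a : p0 a <= pb.
Proof.
rewrite -lee_fin; apply: le_trans sup_le; apply: ereal_sup_ubound.
by exists a.
Qed.

Let p0_lb a : ib <= p0 a.
Proof.
by rewrite -lee_fin; apply: (le_trans le_inf); apply: ereal_inf_lbound; exists a.
Qed.

(* The diagonal entries of [Q] only ever multiply zero increments. *)
Definition off_rate a b : R := if b == a then 0 else Q a b.
Let W := off_rate.

Lemma off_rate_ge0 a b : 0 <= W a b.
Proof.
rewrite /W /off_rate; case: eqP => // ba; have [h _] := rateQ.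
by apply: h; rewrite eq_sym; apply/eqP.
Qed.

Lemma esum_off_rate a : (\esum_(b in [set: F]) (W a b)%:E <= q1%:E)%E.
Proof.
apply: le_trans Q1_le; apply: ereal_sup_ubound; exists a => //.
rewrite esum_mkcond; apply: eq_esum => b _; rewrite /W /off_rate.
case: eqP => [->|ba]; first by rewrite memNset// => /=; rewrite eqxx.
by rewrite mem_set//; apply/eqP.
Qed.

Let W_fin a : (\esum_(b in [set: F]) (W a b)%:E < +oo)%E.
Proof. by apply: le_lt_trans (esum_off_rate a) _; exact: ltry. Qed.

Let W_summable a : abs_summable (W a).
Proof.
by apply: abs_summable_le (W_fin a) => b; rewrite ger0_norm// off_rate_ge0.
Qed.

Lemma sum_off_rate a : signed_sum (W a) <= q1.
Proof.
rewrite signed_sum_ge0E; last exact: off_rate_ge0.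
rewrite -lee_fin fineK ?esum_off_rate//.
by apply: esum_fin_numP => //; exact: off_rate_ge0.
Qed.

Let q1_ge0 (i : F) : 0 <= q1.
Proof.
by apply: le_trans (sum_off_rate i); apply: signed_sum_ge0; exact: off_rate_ge0.
Qed.

Let pb_ge0 (i : F) : 0 <= pb.
Proof. exact: le_trans (p0_ge0 i) (p0_le i). Qed.

Lemma off_rateM_summable a g C : (forall b, `|g b| <= C) ->
  abs_summable (fun b => W a b * g b).
Proof.
move=> gC; have C0 : 0 <= C by apply: le_trans (gC a).
have := abs_summableZ C (W_summable a); apply: abs_summable_le => b.
rewrite normrM mulrC normrM; apply: ler_pM => //.
by apply: le_trans (gC b) (ler_norm _).
Qed.

Lemma off_rate_sum_le a g C c : (forall b, `|g b| <= C) ->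
  0 <= c -> (forall b, g b <= c) -> signed_sum (fun b => W a b * g b) <= q1 * c.
Proof.
move=> gC c0 gc; apply: (@le_trans _ _ (signed_sum (fun b => c * W a b))).
  apply: le_signed_sum => [| |b].
  - exact: off_rateM_summable gC.
  - exact: abs_summableZ.
  - by rewrite mulrC ler_wpM2r ?off_rate_ge0.
by rewrite signed_sumZ// mulrC ler_wpM2r// sum_off_rate.
Qed.

Definition adj (x y : F -> nat) := exists s i i',
  [/\ size s = N.-1, i != i', x = cnt (i :: s) & y = cnt (i' :: s)].

Lemma size_consN i s : size s = N.-1 -> size (i :: s) = N.
Proof. by move=> /= ->; case: N N_ge2. Qed.

Lemma configs_cons i s : size s = N.-1 -> D (cnt (i :: s)).
Proof. by move=> sN; rewrite /D -(size_consN i sN); exact: configs_cnt. Qed.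

Lemma adjD x y : adj x y -> D x /\ D y.
Proof.
by move=> [s [i [i' [sN _ -> ->]]]]; split; exact: configs_cons.
Qed.

Lemma adj_sym x y : adj x y -> adj y x.
Proof.
by move=> [s [i [i' [sN ii' -> ->]]]]; exists s, i', i; rewrite eq_sym.
Qed.

Let c a : R := p0 a / (N%:R - 1).

Let N1 : (0 : R) < N%:R - 1.
Proof. by rewrite subr_gt0 ltr1n. Qed.

Lemma size_rem_cnt a s : a \in s -> size s = N -> size (rem a s) = N.-1.
Proof. by move=> sa sN; rewrite size_rem// sN. Qed.

(** The weight of the departure site and the occupation number in the death term both become sums
    over particles. The dying particle itself occurs in the inner sum, but as a null move with zero
    increment. *)
Lemma fv_generatorE f s : bounded_on D f -> size s = N ->
  fv_generator Q p0 N f (cnt s) = \sum_(a <- s)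
    (signed_sum (fun b => W a b * (f (cnt (b :: rem a s)) - f (cnt s))) +
     \sum_(b <- s) c a * (f (cnt (b :: rem a s)) - f (cnt s))).
Proof.
move=> [M hM] sN; rewrite /fv_generator.
have [_ ->] := signed_sum_cnt s (fun i => signed_sum (fun j =>
  (f (move i j (cnt s)) - f (cnt s)) *
  (Q i j + p0 i * ((cnt s j)%:R / (N%:R - 1))))).
apply: eq_big_seq => a sa.
have [S1 S2] := signed_sum_cnt s
  (fun b => c a * (f (cnt (b :: rem a s)) - f (cnt s))).
rewrite -S2 -signed_sumD//; last first.
  apply: (@off_rateM_summable _ _ (M + M)) => b.
  rewrite (le_trans (ler_normB _ _))// lerD// hM//.
    by apply: configs_cons; exact: size_rem_cnt.
  by rewrite /D -sN; exact: configs_cnt.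
congr signed_sum; apply/funext => b; rewrite move_cnt// /W /off_rate /c.
have [->|_] := eqVneq b a; last by ring.
by rewrite -(cnt_perm (perm_to_rem sa)) subrr; ring.
Qed.

(* The sharp constant is [N (q1 + pb)]; counting also the null moves onto the own
   site gives [N / (N - 1) <= 2] instead of 1 in front of [pb], which the factor
   2 of the final estimate absorbs. *)
Lemma fv_generator_bound f x (B : R) : bounded_on D f -> D x -> 0 <= B ->
  (forall y, adj x y -> `|f y - f x| <= B) ->
  `|fv_generator Q p0 N f x| <= N%:R * (q1 + 2 * pb) * B.
Proof.
move=> bf /configsP[s sN ->] B0 hB; rewrite fv_generatorE//.
have gB a b : a \in s -> `|f (cnt (b :: rem a s)) - f (cnt s)| <= B.
  move=> sa; have [->|ba] := eqVneq b a.
    by rewrite -(cnt_perm (perm_to_rem sa)) subrr normr0.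
  apply: hB; exists (rem a s), a, b; split => //.
  - exact: size_rem_cnt.
  - by rewrite eq_sym.
  - exact/cnt_perm/perm_to_rem.
apply: (le_trans (ler_norm_sum _ _ _)); rewrite -mulrA -sN.
apply: sumr_le_const => a sa.
apply: (le_trans (ler_normD _ _)); rewrite mulrDl; apply: lerD.
  have gn b : `|- (f (cnt (b :: rem a s)) - f (cnt s))| <= B.
    by rewrite normrN gB.
  rewrite ler_norml; apply/andP; split.
    rewrite lerNl -signed_sumN.
    rewrite (_ : (fun b => _) =
      fun b => W a b * - (f (cnt (b :: rem a s)) - f (cnt s))).
      apply: (@off_rate_sum_le _ _ B) => // b.
      by apply: le_trans (gn b); exact: ler_norm.
    by apply/funext => b; rewrite mulrN.
  apply: (@off_rate_sum_le _ _ B) => // b; first exact: gB.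
  by apply: le_trans (gB a b sa); exact: ler_norm.
apply: (le_trans (ler_norm_sum _ _ _)).
have ca0 : 0 <= c a by rewrite divr_ge0// ltW.
apply: (@le_trans _ _ ((size s)%:R * (c a * B))).
  by apply: sumr_le_const => b _; rewrite normrM ger0_norm// ler_wpM2l ?gB.
rewrite sN mulrA ler_wpM2r// /c mulrCA mulrC.
have h : N%:R / (N%:R - 1) <= 2 :> R.
  rewrite ler_pdivrMr//; have : (2 : R) <= N%:R by rewrite ler_nat.
  lra.
by apply: ler_pM => //; rewrite divr_ge0// ltW.
Qed.

(** Isolates the particle at i, where adjacent configurations differ, from the N - 1 common ones.
    For these, the jump onto i after a death is split off: in the coupling it is the only move that
    creates a second discrepancy. *)
Lemma fv_generator_cons f i s : bounded_on D f -> size s = N.-1 ->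
  fv_generator Q p0 N f (cnt (i :: s)) =
  signed_sum (fun b => W i b * (f (cnt (b :: s)) - f (cnt (i :: s)))) +
  \sum_(b <- s) c i * (f (cnt (b :: s)) - f (cnt (i :: s))) +
  \sum_(a <- s)
    (signed_sum (fun b => W a b *
       (f (cnt (b :: i :: rem a s)) - f (cnt (i :: s)))) +
     (c a * (f (cnt (i :: i :: rem a s)) - f (cnt (i :: s))) +
      \sum_(b <- s) c a * (f (cnt (b :: i :: rem a s)) - f (cnt (i :: s))))).
Proof.
move=> bf sN; rewrite fv_generatorE//; last exact: size_consN.
rewrite big_cons [rem i _]/= eqxx big_cons subrr mulr0 add0r; congr (_ + _).
apply: eq_big_seq => a sa.
have e b : cnt (b :: rem a (i :: s)) = cnt (b :: i :: rem a s).
  by apply: cnt_perm; rewrite perm_cons rem_cons_perm.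
rewrite big_cons e; congr (signed_sum _ + (_ + _)).
  by apply/funext => b; rewrite e.
by apply: eq_bigr => b _; rewrite e.
Qed.

(* Two particles jump to the same site at rate [min p p'] and separately at the
   residual rates; [A] and [B] are the resulting increments of a [K]-Lipschitz
   function and [Dl] is its initial difference. *)
Lemma coupling_bound (p p' A B K Dl : R) : 0 <= p -> 0 <= p' ->
  B - A = Dl -> Dl <= K -> `|A| <= K -> `|B| <= K ->
  p * A - p' * B <= - (K * Num.min p p') + (p + p') * (K - Dl).
Proof.
move=> p_ge0 p'_ge0 e DlK; rewrite !ler_norml => /andP[A1 A2] /andP[B1 B2].
have -> : B = A + Dl by lra.
have {e}hA : A <= K - Dl by lra.
case: (leP p p') => pp'.
  have : 0 <= (p' - p) * (K + A) by apply: mulr_ge0; lra.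
  have : 0 <= p * (K - Dl) by apply: mulr_ge0; lra.
  lra.
have : 0 <= (p - p') * (K - Dl - A) by apply: mulr_ge0; lra.
have : 0 <= p' * (K - Dl) by apply: mulr_ge0; lra.
lra.
Qed.

(** Puts lambda into the form of a single sum over the site b where the two particles meet, to be
    compared term by term with the generators. *)
Lemma lambda_le i i' : i != i' -> lam <= signed_sum (fun b =>
  (b == i)%:R * W i' i + ((b == i')%:R * W i i' +
  (if (b == i) || (b == i') then 0 else Num.min (W i b) (W i' b)))).
Proof.
move=> ii'; pose m b :=
  if (b == i) || (b == i') then 0 else Num.min (W i b) (W i' b).
rewrite -/m.
have m0 b : 0 <= m b.
  by rewrite /m; case: ifP => // _; rewrite le_min !off_rate_ge0.
have am : abs_summable m.
  apply: abs_summable_le (W_fin i) => b; rewrite ger0_norm// /m.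
  by case: ifP => _; rewrite ?off_rate_ge0// ge_min lexx.
have mf : (\esum_(b in [set: F]) (m b)%:E)%E \is a fin_num.
  apply: esum_fin_numP => //; apply: le_lt_trans am.
  by apply: le_esum => b _; rewrite lee_fin ler_norm.
have [S1 S2] := signed_sum_single i (fun=> W i' i).
have [S3 S4] := signed_sum_single i' (fun=> W i i').
rewrite signed_sumD//; last exact: abs_summableD.
rewrite signed_sumD// S2 S4 signed_sum_ge0E// -lee_fin !EFinD fineK//.
apply: (le_trans le_lambda); apply: ereal_inf_lbound; exists i, i'; split=> //.
have -> : W i' i = Q i' i by rewrite /W /off_rate (negbTE ii').
have -> : W i i' = Q i i' by rewrite /W /off_rate eq_sym (negbTE ii').
rewrite addeA -EFinD [X in X%:E]addrC; congr (_ + _)%E.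
rewrite [RHS]esum_mkcond; apply: eq_esum => b _; rewrite /m.
case: ifPn => [h|].
  by rewrite memNset//= => -[/negbTE h1 /negbTE h2]; move: h; rewrite h1 h2.
rewrite negb_or => /andP[h1 h2]; rewrite mem_set//=.
by rewrite /W /off_rate (negbTE h1) (negbTE h2).
Qed.

(** Bounds the jump rate of the coupled pair, null moves included: q1 + pb for each differing
    particle, q1 for each of the N - 1 common ones, and N pb for the deaths of these, each having N
    targets at rate at most pb / (N - 1). *)
Definition fv_rate : R := 2 * q1 + 2 * pb + (N%:R - 1) * q1 + N%:R * pb.

(** A maximum principle with slack: where f x - f y attains K the generators differ by at most - rho
    K, and elsewhere the loss is proportional to the gap below K. *)
Lemma fv_generator_lip f K x y : bounded_on D f -> lip adj K f -> adj x y ->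
  fv_generator Q p0 N f x - fv_generator Q p0 N f y <=
  - ((lam - (pb - ib)) * K) + fv_rate * (K - (f x - f y)).
Proof.
move=> bf lf [s [i [i' [sN ii' -> ->]]]].
have K0 : 0 <= K.
  have A : adj (cnt (i :: s)) (cnt (i' :: s)) by exists s, i, i'.
  by have := lf _ _ A; have := lf _ _ (adj_sym A); lra.
have lK j j' r : size r = N.-1 -> f (cnt (j :: r)) - f (cnt (j' :: r)) <= K.
  move=> rN; have [->|jj'] := eqVneq j j'; first by rewrite subrr.
  by apply: lf; exists r, j, j'.
have nK j j' r : size r = N.-1 -> `|f (cnt (j :: r)) - f (cnt (j' :: r))| <= K.
  by move=> rN; rewrite ler_norml lerNl opprB !lK.
rewrite !fv_generator_cons//.
set Dl := f (cnt (i :: s)) - f (cnt (i' :: s)).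
have DleK : Dl <= K by exact: lK.
have DlK : 0 <= K - Dl by rewrite subr_ge0.
have c0 a : 0 <= c a by rewrite divr_ge0// ltW.
have cle a : c a <= pb / (N%:R - 1) by rewrite ler_wpM2r ?invr_ge0// ltW.
have clb a : ib / (N%:R - 1) <= c a by rewrite ler_wpM2r ?invr_ge0// ltW.
have sNR : (size s)%:R = N%:R - 1 :> R.
  by rewrite sN -subn1 natrB//; case: N N_ge2.
have sumW (g g' : F -> R) a a' :
    (forall b, `|g b| <= K) -> (forall b, `|g' b| <= K) ->
    signed_sum (fun b => W a b * g b) - signed_sum (fun b => W a' b * g' b) =
    signed_sum (fun b => W a b * g b - W a' b * g' b).
  by move=> hg hg'; rewrite signed_sumB//; apply: off_rateM_summable; eauto.
(* Mutation of the differing particles. If b is i or i', only one of them moves, onto the other, and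
   the increment is [Dl] up to sign. *)
have T1 : signed_sum (fun b => W i b * (f (cnt (b :: s)) - f (cnt (i :: s)))) -
    signed_sum (fun b => W i' b * (f (cnt (b :: s)) - f (cnt (i' :: s)))) <=
    - (lam * K) + 2 * q1 * (K - Dl).
  rewrite sumW; [|by move=> b; exact: nK|by move=> b; exact: nK].
  have W0 a : W a a = 0 by rewrite /W /off_rate eqxx.
  pose m b := (b == i)%:R * W i' i + ((b == i')%:R * W i i' +
    (if (b == i) || (b == i') then 0 else Num.min (W i b) (W i' b))).
  have am : abs_summable m.
    have [S1 _] := signed_sum_single i (fun=> W i' i).
    have [S2 _] := signed_sum_single i' (fun=> W i i').
    apply: abs_summableD => //; apply: abs_summableD => //.
    apply: abs_summable_le (W_fin i) => b; case: ifP => _.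
      by rewrite normr0 off_rate_ge0.
    by rewrite ger0_norm ?ge_min ?lexx// le_min !off_rate_ge0.
  have aW : abs_summable (fun b => W i b + W i' b) by exact: abs_summableD.
  apply: (@le_trans _ _ (signed_sum (fun b => (- K) * m b +
      (K - Dl) * (W i b + W i' b)))).
    apply: le_signed_sum.
    - apply: abs_summableD; first by apply: off_rateM_summable => b; exact: nK.
      by apply: abs_summableN; apply: off_rateM_summable => b; exact: nK.
    - by apply: abs_summableD; exact: abs_summableZ.
    - move=> b; rewrite mulNr [(K - Dl) * _]mulrC /m.
      have [->|bi] := eqVneq b i.
        rewrite (negbTE ii') /= W0 -/Dl.
        by have := off_rate_ge0 i' i; lra.
      have [->|bi'] := eqVneq b i'.
        rewrite /= W0 -[_ - f (cnt (i :: s))]opprB -/Dl.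
        by have := off_rate_ge0 i i'; lra.
      rewrite !mul0r !add0r; apply: coupling_bound; rewrite ?off_rate_ge0 ?nK//.
      by rewrite /Dl; ring.
  rewrite signed_sumD; [|exact: abs_summableZ|exact: abs_summableZ].
  rewrite !signed_sumZ// signed_sumD//; apply: lerD.
    by rewrite mulNr lerN2 mulrC ler_wpM2l// lambda_le.
  by rewrite mulrC ler_wpM2r// mulr_natl mulr2n lerD// sum_off_rate.
(* Death of the differing particles: each of the N - 1 common particles is a joint target at rate at
   least ib / (N - 1). *)
have T2 : \sum_(b <- s) c i * (f (cnt (b :: s)) - f (cnt (i :: s))) -
    \sum_(b <- s) c i' * (f (cnt (b :: s)) - f (cnt (i' :: s))) <=
    - (ib * K) + 2 * pb * (K - Dl).
  rewrite -sumrB; apply: (le_trans (sumr_le_const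
    (C := - (K * (ib / (N%:R - 1))) +
          (pb / (N%:R - 1) + pb / (N%:R - 1)) * (K - Dl)) _)).
    move=> b _; apply: (le_trans
      (coupling_bound (Dl := Dl) (K := K) _ _ _ _ _ _)) => //.
    - by rewrite /Dl; ring.
    - exact: nK.
    - exact: nK.
    - apply: lerD; last by rewrite ler_wpM2r// lerD.
      by rewrite lerN2 ler_wpM2l// le_min !clb.
  rewrite sNR le_eqVlt; apply/orP; left; apply/eqP; field.
  by rewrite gt_eqF.
(* Common particles move together. A joint move to b leaves one discrepancy and adds at most K - Dl;
   a jump onto the differing particle leaves two and adds at most 2 K - Dl, which over all common
   particles costs pb K. *)
have T34 : \sum_(a <- s)
    (signed_sum (fun b => W a b *
       (f (cnt (b :: i :: rem a s)) - f (cnt (i :: s)))) +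
     (c a * (f (cnt (i :: i :: rem a s)) - f (cnt (i :: s))) +
      \sum_(b <- s) c a * (f (cnt (b :: i :: rem a s)) - f (cnt (i :: s))))) -
   \sum_(a <- s)
    (signed_sum (fun b => W a b *
       (f (cnt (b :: i' :: rem a s)) - f (cnt (i' :: s)))) +
     (c a * (f (cnt (i' :: i' :: rem a s)) - f (cnt (i' :: s))) +
      \sum_(b <- s) c a * (f (cnt (b :: i' :: rem a s)) - f (cnt (i' :: s))))) <=
   (N%:R - 1) * q1 * (K - Dl) + pb * K + N%:R * pb * (K - Dl).
  rewrite -sumrB; pose cm := pb / (N%:R - 1).
  apply: (le_trans (sumr_le_const (C := q1 * (K - Dl) +
      (cm * (K + (K - Dl)) + (N%:R - 1) * (cm * (K - Dl)))) _)); last first.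
    rewrite sNR le_eqVlt; apply/orP; left; apply/eqP; rewrite /cm; field.
    by rewrite gt_eqF.
  move=> a sa.
  have rN j : size (j :: rem a s) = N.-1.
    by rewrite /= size_rem// -sN; case: (s) sa.
  have step b : f (cnt (b :: i :: rem a s)) - f (cnt (i :: s)) -
      (f (cnt (b :: i' :: rem a s)) - f (cnt (i' :: s))) <= K - Dl.
    have e j : cnt (b :: j :: rem a s) = cnt (j :: b :: rem a s).
      by rewrite !cnt_cons; apply/funext => z; rewrite addnCA.
    by have := lK i i' _ (rN b); rewrite !e /Dl; lra.
  have sub3 (u v w u' v' w' : R) :
    u + (v + w) - (u' + (v' + w')) = u - u' + (v - v' + (w - w')) by ring.
  rewrite sub3; apply: lerD; last apply: lerD.
  - have sa' j : cnt (j :: s) = cnt (a :: j :: rem a s).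
      rewrite !cnt_cons (cnt_perm (perm_to_rem sa)) cnt_cons.
      by apply/funext => z; rewrite addnCA.
    rewrite sumW; first last.
    - by move=> b; rewrite sa'; exact: nK.
    - by move=> b; rewrite sa'; exact: nK.
    rewrite (_ : (fun b => _) = fun b => W a b *
        (f (cnt (b :: i :: rem a s)) - f (cnt (i :: s)) -
         (f (cnt (b :: i' :: rem a s)) - f (cnt (i' :: s))))); last first.
      by apply/funext => b; rewrite -mulrBr.
    apply: (@off_rate_sum_le _ _ (K + K)) => // b.
    apply: (le_trans (ler_normB _ _)); apply: lerD; rewrite sa'; exact: nK.
  - rewrite -mulrBr; apply: (@le_trans _ _ (c a * (K + (K - Dl)))).
      rewrite ler_wpM2l//.
      (* Two discrepancies are bridged by the configuration with one particle at i and one at i'. *)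
      have e : cnt (i' :: i :: rem a s) = cnt (i :: i' :: rem a s).
        by rewrite !cnt_cons; apply/funext => z; rewrite addnCA.
      have := lK i i' _ (rN i); have := lK i i' _ (rN i'); rewrite e /Dl; lra.
    by apply: ler_wpM2r; [exact: addr_ge0 | exact: cle].
  - rewrite -sumrB -sNR; apply: sumr_le_const => b _; rewrite -mulrBr.
    by apply: (le_trans (ler_wpM2l (c0 a) (step b))); rewrite ler_wpM2r.
rewrite /fv_rate; lra.
Qed.

End FlemingViotGenerator.

(** * Signs and finiteness of the constants *)

Lemma decay_ge0 (R : realType) (r : \bar R) (t : R) : 0 <= t -> 0 <= decay r t.
Proof.
move=> t0; case: r => [u| |] //=; rewrite /decay; case: eqP => [_|/eqP u0].
  by rewrite mulr_ge0.
have [up|un] := ltP 0 u.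
  rewrite divr_ge0 ?(ltW up)// subr_ge0 -(expR0 R) ler_expR oppr_le0.
  by rewrite !mulr_ge0// ltW.
rewrite mulr_le0// ?invr_le0// subr_le0 -(expR0 R) ler_expR oppr_ge0.
by rewrite mulr_le0_ge0// mulr_ge0_le0.
Qed.

Section FiniteConstants.
Variables (R : realType) (F : countType) (Q : F -> F -> R) (p0 : F -> R).
Hypothesis rateQ : rate_matrix Q.
Hypothesis p0_ge0 : forall i, 0 <= p0 i.
Hypothesis Q1_lt : (Q1 Q < +oo)%E.
Hypothesis sup_lt : (sup_death p0 < +oo)%E.
Implicit Types i : F.

Lemma Q1_fin_num i : Q1 Q \is a fin_num.
Proof.
rewrite ge0_fin_numE//.
apply: (@le_trans _ _ (\esum_(j in [set j | j != i]) (Q i j)%:E)%E).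
  by apply: esum_ge0 => j ji; rewrite lee_fin rateQ.1// eq_sym.
by apply: ereal_sup_ubound; exists i.
Qed.

Lemma sup_death_fin_num i : sup_death p0 \is a fin_num.
Proof.
rewrite ge0_fin_numE//; apply: (@le_trans _ _ (p0 i)%:E); rewrite ?lee_fin//.
by apply: ereal_sup_ubound; exists i.
Qed.

Lemma inf_death_fin_num i : inf_death p0 \is a fin_num.
Proof.
rewrite ge0_fin_numE; last first.
  by apply: le_ereal_inf_tmp => _ [j _ <-]; rewrite lee_fin.
apply: (@le_lt_trans _ _ (p0 i)%:E); last exact: ltry.
by apply: ereal_inf_lbound; exists i.
Qed.

(** A second site is essential: on one site the infimum is over the empty set, hence infinite. Any
    single pair bounds it by a finite rate plus [Q1]. *)
Lemma lambda_fin_num i i' : i != i' -> lambda Q \is a fin_num.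
Proof.
move=> ii'; rewrite ge0_fin_numE; last first.
  apply: le_ereal_inf_tmp => _ [j [j' [jj' ->]]].
  apply: adde_ge0; first by rewrite lee_fin addr_ge0// rateQ.1// eq_sym.
  apply: esum_ge0 => b [bj bj']; rewrite lee_fin le_min.
  by rewrite !rateQ.1// eq_sym.
pose m : \bar R := (\esum_(j in [set j | j != i /\ j != i'])
  (Num.min (Q i j) (Q i' j))%:E)%E.
have mQ : (m <= Q1 Q)%E.
  apply: (@le_trans _ _ (\esum_(j in [set j | j != i]) (Q i j)%:E)%E); last first.
    by apply: ereal_sup_ubound; exists i.
  rewrite /m esum_mkcond [leRHS]esum_mkcond; apply: le_esum => b _.
  case: ifPn => [|_].
    by rewrite inE => -[bi _]; rewrite mem_set// lee_fin ge_min lexx.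
  by case: ifPn => //; rewrite inE => bi; rewrite lee_fin rateQ.1// eq_sym.
apply: (@le_lt_trans _ _ ((Q i i' + Q i' i)%:E + m)%E).
  by apply: ereal_inf_lbound; exists i, i'.
by rewrite lte_add_pinfty ?ltry//; exact: le_lt_trans Q1_lt.
Qed.

End FiniteConstants.

(** * Occupation fractions and the covariance estimate *)

Section OccupationNumbers.
Variables (R : realType) (F : countType) (N : nat).
Hypothesis N_ge2 : (2 <= N)%N.
Implicit Types (eta : F -> nat) (k : F).

Definition frac k eta : R := (eta k)%:R / N%:R.

Lemma frac_le1 k eta : configs R N eta -> `|frac k eta| <= 1.
Proof.
move=> /configsP[s sN ->]; rewrite ger0_norm ?divr_ge0// ler_pdivrMr; last first.
  by rewrite ltr0n ltnW.
by rewrite mul1r ler_nat -sN; exact: count_size.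
Qed.

Lemma lip_frac k : lip (adj (F:=F) N) N%:R^-1 (frac k).
Proof.
move=> x y [s [i [i' [_ _ -> ->]]]]; rewrite /frac !cnt_cons !natrD -mulrBl.
rewrite ler_piMl ?invr_ge0// opprD addrACA subrr addr0.
by case: (k == i); case: (k == i') => /=; lra.
Qed.

End OccupationNumbers.

Theorem theorem1p3 (R : realType) (F : countType)
    (Q : F -> F -> R) (p0 : F -> R) (N : nat)
    (d : measure_display) (Omega : measurableType d)
    (P : (F -> nat) -> probability Omega R) (X : R -> Omega -> F -> nat)
    (hQ : irreducible_positive_recurrent Q)
    (p0_ge0 : forall i, 0 <= p0 i)
    (p0_neq0 : exists i, p0 i != 0)
    (N_ge2 : (2 <= N)%N)
    (hX : fleming_viot Q p0 N P X)
    (Q1_fin : (Q1 Q < +oo)%E)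
    (p_fin : (sup_death p0 < +oo)%E) :
  forall (k l : F) (eta : F -> nat) (t : R),
    configs R N eta -> 0 <= t ->
    (`| 'E_(P eta)[fun w => (((X t w k)%:R / N%:R) * ((X t w l)%:R / N%:R))%R]
        - 'E_(P eta)[fun w => ((X t w k)%:R / N%:R)%R]
          * 'E_(P eta)[fun w => ((X t w l)%:R / N%:R)%R] |
     <= (2 * (fine (Q1 Q) + fine (sup_death p0)) / (N%:R - 1)
          * decay (rho Q p0) t)%:E)%E.
Proof.
move=> k l eta t Deta t0.
have [rateQ _] := hQ; have [mX gX] := hX.
have Q1f := Q1_fin_num rateQ Q1_fin k.
have supf := sup_death_fin_num p0_ge0 p_fin k.
have inff := inf_death_fin_num p0_ge0 k.
set q1 := fine (Q1 Q); set pb := fine (sup_death p0).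
have Q1_le : (Q1 Q <= q1%:E)%E by rewrite fineK.
have sup_le : (sup_death p0 <= pb%:E)%E by rewrite fineK.
have q1_ge0 : 0 <= q1.
  rewrite -lee_fin fineK//; apply: le_trans (ereal_sup_ubound _); last by exists k.
  by apply: esum_ge0 => j jk; rewrite lee_fin rateQ.1// eq_sym.
have pb_ge0 : 0 <= pb.
  rewrite -lee_fin fineK//; apply: (@le_trans _ _ (p0 k)%:E); rewrite ?lee_fin//.
  by apply: ereal_sup_ubound; exists k.
have N0 : (0 : R) < N%:R by rewrite ltr0n ltnW.
have N1 : (0 : R) < N%:R - 1 by rewrite subr_gt0 ltr1n.
have bf (j : F) : bounded_on (configs R N) (frac R N j).
  by exists 1 => y; exact: frac_le1.
have bfg : bounded_on (configs R N) (fun y => frac R N k y * frac R N l y).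
  exact: bounded_onM.
have EE f : bounded_on (configs R N) f ->
    ('E_(P eta)[fun w => f (X t w)] = (semigroup P X t f eta)%:E)%E.
  move=> bdf; rewrite -semigroupE fineK// unlock.
  by apply: integrable_fin_num => //; exact: (integrable_X mX).
rewrite (EE _ bfg) (EE _ (bf k)) (EE _ (bf l)) -EFinM -EFinB abse_EFin lee_fin.
have decay0 := decay_ge0 (rho Q p0) t0.
(* On a single site there is only one configuration, so the covariance is 0 and it suffices that the
   bound is nonnegative. *)
have [[i [i' ii']]|one] := pselect (exists i i' : F, i != i'); last first.
  have etaE y : configs R N y -> y = eta.
    have eqF (a b : F) : a = b.
      by apply: contrapT => /eqP ab; apply: one; exists a, b.
    move=> /configsP[s sN ->]; have /configsP[s' s'N ->] := Deta.
    congr cnt; apply: (@eq_from_nth _ k); first by rewrite sN.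
    by move=> j _; exact: eqF.
  have cstE f : bounded_on (configs R N) f -> semigroup P X t f eta = f eta.
    move=> bdf; rewrite -[RHS](semigroup_cst P X t (f eta) eta).
    by apply/eqP; rewrite eq_le !(semigroup_le mX)//;
      try exact: bounded_on_cst; move=> y /etaE ->.
  rewrite !cstE// subrr normr0 mulr_ge0// divr_ge0 ?(ltW N1)//.
  by rewrite mulr_ge0// addr_ge0.
have lamf := lambda_fin_num rateQ Q1_fin ii'.
set ib := fine (inf_death p0); pose lam := fine (lambda Q).
have le_inf : (ib%:E <= inf_death p0)%E by rewrite fineK.
have le_lam : (lam%:E <= lambda Q)%E by rewrite fineK.
have rhoE : rho Q p0 = (lam - (pb - ib))%:E.
  by rewrite /rho !EFinB !fineK.
rewrite rhoE in decay0 *.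
have q0 : 0 <= N%:R * (q1 + 2 * pb) by rewrite mulr_ge0// addr_ge0// mulr_ge0.
have L_lip f K x y h : bounded_on (configs R N) f -> lip (adj (F:=F) N) K f ->
    adj N x y -> 0 <= h -> h * fv_rate N q1 pb <= 1 ->
    f x + h * fv_generator Q p0 N f x - (f y + h * fv_generator Q p0 N f y) <=
    (1 - (lam - (pb - ib)) * h) * K.
  move=> bdf lf xy h0 hr; have fxy := lf _ _ xy.
  have := fv_generator_lip rateQ p0_ge0 N_ge2 Q1_le sup_le le_inf le_lam bdf lf xy.
  move=> /(ler_wpM2l h0).
  (* For such h the slack term costs at most K - (f x - f y), exactly what the initial difference
     falls short of K. *)
  have : h * fv_rate N q1 pb * (K - (f x - f y)) <= 1 * (K - (f x - f y)).
    by rewrite ler_wpM2r// subr_ge0.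
  lra.
have K0 : (0 : R) <= N%:R^-1 by rewrite invr_ge0.
have gen f : bounded_on (configs R N) f -> forall x, configs R N x ->
    (semigroup P X t f x - f x) / t @[t --> 0^'+] --> fv_generator Q p0 N f x.
  move=> bdf x Dx; have := gX f bdf x Dx.
  by under eq_fun do rewrite semigroupE.
have main : `|cov (semigroup P X) t (frac R N k) (frac R N l) eta| <=
    N%:R * (q1 + 2 * pb) * N%:R^-1 ^+ 2 * decay (lam - (pb - ib))%:E t.
  apply: (@cov_lip _ _ (configs R N) _ (fv_generator Q p0 N) (adj N) _ _
    (fv_rate N q1 pb)).
  - by move=> s a f g x s0 hf hg _; exact: (semigroup_lin mX).
  - by move=> s c x _ _; exact: semigroup_cst.
  - by move=> s f g x s0 hf hg _; exact: (semigroup_le mX).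
  - by move=> s u f x; apply: (semigroup_add mX); exact: countable_configs.
  - by move=> f x; exact: (semigroup_0 mX).
  - exact: gen.
  - by move=> x y; exact: adjD.
  - by move=> x y; exact: adj_sym.
  - exact: q0.
  - by move=> f x B; exact: fv_generator_bound.
  - exact: L_lip.
  - exact: t0.
  - exact: Deta.
  - exact: K0.
  - by move=> y; exact: frac_le1.
  - by move=> y; exact: frac_le1.
  - exact: lip_frac.
  - exact: lip_frac.
apply: (le_trans main).
rewrite ler_wpM2r//.
(* This is q times the squared Lipschitz constant 1 / N^2; numerator and denominator are then
   weakened separately. *)
rewrite [leLHS](_ : _ = (q1 + 2 * pb) / N%:R); last by field; rewrite gt_eqF.
apply: ler_pM => //.
- by rewrite addr_ge0// mulr_ge0.
- by rewrite mulrDr lerD2r ler_peMl// ler1n.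
- by rewrite lef_pV2 ?posrE// gerBl.
Qed.
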